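(* Let $G$ be a group and $N$ a normal subgroup of $G$. Assume that a coarse kernel $A$ of $$\iota_{\mathbb{Q}}:(\mathcal{C}_{\mathbb{Q}}(G,N),\mathrm{scl}_{G,N})\to(\mathcal{C}_{\mathbb{Q}}(G),\mathrm{scl}_G),\qquad c\mapsto c,$$ exists. Then, for every $\mu\in\mathrm{Q}(N)^G$, the following are equivalent. (i) $[\mu]=0$ in $\mathrm{W}(G,N)$; in other words, there exists $\phi\in\mathrm{Q}(G)$ such that $\mu-\phi|_N\in\mathrm{H}^1(N)^G$. (ii) $\mu(A)$ is a bounded subset of $\mathbb{R}$.
   Context: Quasimorphisms: for a group $H$ and $f:H\to\mathbb{R}$, the defect is $D_H(f)=\sup\{|f(h_1h_2)-f(h_1)-f(h_2)| : h_1,h_2\in H\}$; $f$ is a quasimorphism if $D_H(f)<\infty$, and homogeneous if its restriction to every cyclic subgroup is a homomorphism. $\mathrm{Q}(H)$ is the real vector space of homogeneous quasimorphisms on $H$, $\mathrm{H}^1(H)=\mathrm{Hom}(H,\mathbb{R})$. $\mathrm{Q}(N)^G$ and $\mathrm{H}^1(N)^G$ are the subspaces of $\mathrm{Q}(N)$ and $\mathrm{H}^1(N)$ of elements invariant under conjugation by $G$. With $i^*:\mathrm{Q}(G)\to\mathrm{Q}(N)^G$, $\phi\mapsto\phi|_N$, define $\mathrm{W}(G,N)=\mathrm{Q}(N)^G/(\mathrm{H}^1(N)^G+i^*\mathrm{Q}(G))$. Chains: for $R\in\{\mathbb{Z},\mathbb{Q}\}$, $\mathrm{C}_k(G;R)$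 is the free $R$-module on $G^k$, and $\partial:\mathrm{C}_2(G;R)\to\mathrm{C}_1(G;R)$ is $\partial(g_1,g_2)=g_2-g_1g_2+g_1$. $\mathrm{C}_2'(G,N;R)$ is the submodule generated by those $(g_1,g_2)$ with $g_1\in N$ or $g_2\in N$. Put $\mathrm{B}_1'(G,N;R)=\partial\mathrm{C}'_2(G,N;R)$, $\mathcal{C}_R(G,N)=\mathrm{C}_1(N;R)\cap\mathrm{B}'_1(G,N;R)$, and $\mathcal{C}_R(G)=\mathcal{C}_R(G,G)$. A function $\mu$ on $N$ is evaluated on chains by linear extension; $\mu(A)=\{\mu(c):c\in A\}$. Mixed scl on chains: for $y\in[G,N]$ (the subgroup generated by all $[g,x]=gxg^{-1}x^{-1}$, $g\in G$, $x\in N$), $\mathrm{cl}_{G,N}(y)$ is the minimal number of such commutators whose product is $y$. An element of $\mathcal{C}_{\mathbb{Z}}(G,N)$ is expressed as $c=x_1+\dots+x_m-\check x_1-\dots-\check x_n$ with $x_i,\check x_j\in N$; for such an expression set $\mathrm{cl}_{G,N}(c)=\inf\mathrm{cl}_{G,N}(\xi_1\cdots\xi_m\eta_1^{-1}\cdots\eta_n^{-1})$, where $\xi_i$ runs over the $G$-conjugates of $x_i$ and $\eta_j$ over the $G$-conjugates of $\check x_j$. Then $\mathrm{scl}_{G,N}(c)=\lim_{k\to\infty}\frac1k\mathrm{cl}_{G,N}(x_1^k+\dots+x_m^k-\check x_1^k-\dots-\check x_n^k)$. For $c\in\mathcal{C}_{\mathbb{Q}}(G,N)$, $\mathrm{scl}_{G,N}(c)=\mathrm{scl}_{G,N}(kc)/k$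 for any $k\in\mathbb{N}$ with $kc\in\mathcal{C}_{\mathbb{Z}}(G,N)$. It is known that this is well-defined and gives a seminorm on the $\mathbb{Q}$-vector space $\mathcal{C}_{\mathbb{Q}}(G,N)$; $\mathrm{scl}_G=\mathrm{scl}_{G,G}$. These seminorms are used as (pseudo-)metrics $d(c,c')=\mathrm{scl}(c-c')$. Coarse kernel: for subsets $A,B$ of a (pseudo-)metric space $(X,d_X)$, $A\precsim B$ means that there is $R\ge0$ such that every $a\in A$ satisfies $d_X(a,b)\le R$ for some $b\in B$. A coarse kernel of $\iota_{\mathbb Q}$ is a subset $A\subseteq\mathcal{C}_{\mathbb{Q}}(G,N)$ such that $\iota_{\mathbb Q}(A)$ is bounded with respect to $\mathrm{scl}_G$ and $B\precsim A$ (with respect to $\mathrm{scl}_{G,N}$) for every $B\subseteq\mathcal{C}_{\mathbb{Q}}(G,N)$ with $\iota_{\mathbb Q}(B)$ bounded with respect to $\mathrm{scl}_G$. *)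

(* Defs.v *)
From HB Require Import structures.
From mathcomp Require Import all_boot all_order all_algebra.
From mathcomp Require Import all_classical all_reals all_analysis.
From mathcomp Require Import freeg.

Set Implicit Arguments.
Unset Strict Implicit.
Unset Printing Implicit Defensive.

Import Order.TTheory GRing.Theory Num.Theory.
Import numFieldNormedType.Exports.

Local Open Scope classical_set_scope.
Local Open Scope ring_scope.

Definition normal_subgroup (G : groupType) (N : set G) : Prop :=
  group_closed [in N] /\ forall g x, N x -> N (x ^ g)%g.

(* A function on a subgroup H of G is represented by a total function on G of
   which only the values on H are used; two such functions stand for the same
   function on H when they agree on H. *)
Section Quasimorphisms.
Context {R : realType} {G : groupType}.
Implicit Types (H N : set G) (f : G -> R).

Definition defect H f : \bar R :=
  ereal_sup [set d | exists h1 h2, [/\ H h1, H h2 &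
    d = `|f (h1 * h2)%g - f h1 - f h2|%:E]].

Definition quasimorphism H f : Prop := (defect H f < +oo)%E.

Definition hom_on H f : Prop :=
  forall x y, H x -> H y -> f (x * y)%g = f x + f y.

Definition cyclic_subgroup (x : G) : set G :=
  [set y | exists n, y = (x ^+ n)%g \/ y = (x ^- n)%g].

Definition homogeneous H f : Prop :=
  forall x, H x -> hom_on (cyclic_subgroup x) f.

Definition conj_invariant N f : Prop := forall g x, N x -> f (x ^ g)%g = f x.

(* Q(H) *)
Definition Q H : set (G -> R) :=
  [set f | quasimorphism H f /\ homogeneous H f].

(* Q(N)^G *)
Definition Q_inv N : set (G -> R) := [set f | Q N f /\ conj_invariant N f].

(* H^1(N)^G *)
Definition H1_inv N : set (G -> R) :=
  [set f | hom_on N f /\ conj_invariant N f].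

End Quasimorphisms.

Section Chains.
Context (K : nzRingType) {G : groupType}.
Implicit Types N : set G.

Definition boundary (e : {freeg (G * G)%type / K}) : {freeg G / K} :=
  fglift (fun p : G * G => << p.2 >> - << (p.1 * p.2)%g >> + << p.1 >>) e.

(* C_1(N; K), seen inside C_1(G; K) *)
Definition C1 N : set {freeg G / K} :=
  [set c | forall x, x \in dom c -> N x].

(* C_2'(G, N; K) *)
Definition C2' N : set {freeg (G * G)%type / K} :=
  smallest (fun S : set {freeg (G * G)%type / K} => submod_closed [in S])
    [set << p >> | p in [set p : G * G | N p.1 \/ N p.2]].

Definition B1' N : set {freeg G / K} := boundary @` C2' N.

Definition mixed_boundaries N : set {freeg G / K} := C1 N `&` B1' N.

End Chains.

(* C_Z(G, N) and C_Q(G, N); C_Q(G) is CQ setT *)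
Definition CZ (G : groupType) (N : set G) : set {freeg G / int} :=
  mixed_boundaries (K := int) N.
Definition CQ (G : groupType) (N : set G) : set {freeg G / rat} :=
  mixed_boundaries (K := rat) N.

Definition chain_intr (G : groupType) (z : {freeg G / int}) : {freeg G / rat} :=
  \sum_(x <- dom z) << (coeff x z)%:~R *g x >>.

Definition chain_eval (R : realType) (G : groupType) (mu : G -> R)
    (c : {freeg G / rat}) : R :=
  \sum_(x <- dom c) ratr (coeff x c) * mu x.

Section StableCommutatorLength.
Context (R : realType) {G : groupType}.
Implicit Types (N : set G).

(* The value is +oo exactly off the subgroup [G, N]. Note that [~ g, x] of the
   library is g^-1 x^-1 g x, which is not the convention used here. *)
Definition cl N (y : G) : \bar R :=
  ereal_inf [set l%:R%:E | l in [set l : nat |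
    exists g x : 'I_l -> G, (forall i, N (x i)) /\
      y = (\prod_(i < l) (g i * x i * (g i)^-1 * (x i)^-1))%g]].

(* cl_{G,N} of the expression x_1 + ... + x_m - y_1 - ... - y_n *)
Definition cl_expr N m n (x : 'I_m -> G) (y : 'I_n -> G) : \bar R :=
  ereal_inf [set l | exists (g : 'I_m -> G) (h : 'I_n -> G),
    l = cl N (\prod_(i < m) (x i ^ g i) * \prod_(j < n) (y j ^ h j)^-1)%g].

Definition scl_expr N m n (x : 'I_m -> G) (y : 'I_n -> G) : \bar R :=
  limn (fun k : nat => k%:R^-1%:E *
    cl_expr N (fun i => (x i ^+ k)%g) (fun j => (y j ^+ k)%g))%E.

(* [xget] selects the common value over all expressions of z; the default +oo
   is only returned when z has no expression, i.e. off C_1(N; Z). *)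
Definition sclZ N (z : {freeg G / int}) : \bar R :=
  xget +oo%E [set v | exists m n (x : 'I_m -> G) (y : 'I_n -> G),
    [/\ forall i, N (x i), forall j, N (y j),
        z = \sum_(i < m) << x i >> - \sum_(j < n) << y j >> &
        v = scl_expr N x y]].

(* Likewise over all k; every c in C_Q(G, N) has a positive multiple in
   C_Z(G, N), so the default +oo is not returned on C_Q(G, N). *)
Definition scl N (c : {freeg G / rat}) : \bar R :=
  xget +oo%E [set v | exists (k : nat) (z : {freeg G / int}),
    [/\ (0 < k)%N, CZ N z, chain_intr z = k%:R *: c &
        v = (k%:R^-1%:E * sclZ N z)%E]].

Definition scl_dist N (c c' : {freeg G / rat}) : \bar R := scl N (c - c').

End StableCommutatorLength.

(* Pseudo-metrics are given as functions to \bar R, considered on a subset of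
   the type on which they are finite. *)
Section Coarse.
Context {R : realType} {T U : Type}.

Definition dist_bounded V (d : V -> V -> \bar R) (B : set V) : Prop :=
  exists r : R, forall b b', B b -> B b' -> (d b b' <= r%:E)%E.

Definition coarsely_contained (d : T -> T -> \bar R) (A B : set T) : Prop :=
  exists r : R, 0 <= r /\
    forall a, A a -> exists b, B b /\ (d a b <= r%:E)%E.

Definition coarse_kernel (X : set T) (dX : T -> T -> \bar R)
    (dY : U -> U -> \bar R) (f : T -> U) (A : set T) : Prop :=
  [/\ A `<=` X, dist_bounded dY (f @` A) &
      forall B, B `<=` X -> dist_bounded dY (f @` B) ->
        coarsely_contained dX B A].

End Coarse.

(* The inclusion of C_Q(G, N) into C_Q(G), both sitting in C_1(G; Q). *)
Definition iotaQ (G : groupType) (c : {freeg G / rat}) : {freeg G / rat} := c.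

(* Main.v *)
(** A G-invariant homogeneous quasimorphism mu on N of defect D changes by at
    most 2D when its argument is multiplied by a mixed commutator, so
    |mu(c)| <= 2D scl_{G,N}(c) on C_Q(G,N). If mu = phi|_N + h with phi in Q(G)
    and h in H^1(N)^G, then h vanishes on C_Q(G,N), and the same estimate for
    phi and scl_G bounds mu on A.

    Conversely, if mu(A) is bounded then mu is bounded on the unit ball of
    C_Q(G,N) for the filling seminorm
      |c| = inf { sum of |a_i| over the i with g_i, h_i not commuting :
                  c = sum_i a_i d(g_i,h_i) },
    because scl_G <= |.|, so that this ball lies within bounded scl_{G,N}
    distance of A. By Hahn-Banach over Q, mu extends from C_Q(G,N) to a
    Q-linear functional F on C_1(G;Q) bounded on fillings by a multiple of |.|.
    Then phi(g) = F(g) has bounded defect and is additive on commuting pairs,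
    and mu - phi is an invariant homomorphism on N because F = mu on C_Q(G,N).

    Only one-sided bounds on scl enter, valid for every expression of a chain,
    so its independence of the expression is never needed; the existence of the
    limit defining it (Fekete) is. *)

Require Import Defs.
From HB Require Import structures.
From mathcomp Require Import all_boot all_order all_algebra.
From mathcomp Require Import all_classical all_reals all_analysis.
From mathcomp Require Import freeg.
From mathcomp Require Import lra ring zify.

Set Implicit Arguments.
Unset Strict Implicit.
Unset Printing Implicit Defensive.

Import Order.TTheory GRing.Theory Num.Theory.
Import numFieldNormedType.Exports.

Local Open Scope classical_set_scope.
Local Open Scope ring_scope.

(** * Commutator length up to bounded error *)

Section NormalSubgroup.
Context {G : groupType} {N : set G}.
Hypothesis nN : normal_subgroup N.

Lemma normal1 : N 1%g.
Proof. by have [[/set_mem]] := nN. Qed.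

Lemma normalV x : N x -> N x^-1%g.
Proof.
move=> Nx; have [[_ Nd] _] := nN.
by rewrite -[x^-1%g]mul1g; apply/set_mem/Nd; apply/mem_set => //;
  exact: normal1.
Qed.

Lemma normalM x y : N x -> N y -> N (x * y)%g.
Proof.
move=> Nx Ny; have [[_ Nd] _] := nN.
by rewrite -[y]invgK; apply/set_mem/Nd; apply/mem_set => //; exact: normalV.
Qed.

Lemma normalJ g x : N x -> N (x ^ g)%g.
Proof. by have [_] := nN; apply. Qed.

Lemma normalX x k : N x -> N (x ^+ k)%g.
Proof.
move=> Nx; elim: k => [|k IH]; first by rewrite expg0; exact: normal1.
by rewrite expgS; exact: normalM.
Qed.

Lemma normal_prod (I : eqType) (s : seq I) (f : I -> G) :
  {in s, forall i, N (f i)} -> N (\prod_(i <- s) f i)%g.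
Proof.
elim: s => [|i s IH] Ns; first by rewrite big_nil; exact: normal1.
rewrite big_cons; apply: normalM; first by apply: Ns; rewrite mem_head.
by apply: IH => j js; apply: Ns; rewrite inE js orbT.
Qed.

(** Recursive form of the products that occur in [cl], suited to induction on the number of
    commutators. *)
Inductive mixed_prod : nat -> G -> Prop :=
| mixed_prod0 : mixed_prod 0 1%g
| mixed_prodS l g x y : N x -> mixed_prod l y ->
    mixed_prod l.+1 (g * x * g^-1 * x^-1 * y)%g.

Lemma mixed_prodE l y : mixed_prod l y <->
  exists g x : 'I_l -> G, (forall i, N (x i)) /\
      y = (\prod_(i < l) (g i * x i * (g i)^-1 * (x i)^-1))%g.
Proof.
split=> [|[g [x [Nx ->]]]].
  elim=> [|{}l g x {}y Nx _ [gs [xs [Nxs ->]]]].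
    exists (fun=> 1%g), (fun=> 1%g); split; last by rewrite big_ord0.
    by move=> _; exact: normal1.
  exists (fun i => if unlift ord0 i is Some j then gs j else g).
  exists (fun i => if unlift ord0 i is Some j then xs j else x).
  split=> [i|]; first by case: unliftP.
  rewrite big_ord_recl unlift_none; congr (_ * _)%g.
  by apply: eq_bigr => i _; rewrite liftK.
elim: l => [|l IH] in g x Nx *; first by rewrite big_ord0; exact: mixed_prod0.
by rewrite big_ord_recl; apply: mixed_prodS => //; exact: IH.
Qed.

Lemma mixed_prodD l l' y y' :
  mixed_prod l y -> mixed_prod l' y' -> mixed_prod (l + l') (y * y')%g.
Proof.
move=> H H'; elim: H => [|{}l g x {}y Nx _ IH]; first by rewrite mul1g.
by rewrite addSn -mulgA; exact: mixed_prodS.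
Qed.

Lemma mixed_prod_comm g x : N x -> mixed_prod 1 (g * x * g^-1 * x^-1)%g.
Proof.
by move=> Nx; rewrite -[X in mixed_prod _ X]mulg1; apply: mixed_prodS => //;
  exact: mixed_prod0.
Qed.

(** Padding with trivial commutators turns exact counts into upper bounds. *)
Lemma mixed_prod_leq l l' y : (l <= l')%N -> mixed_prod l y -> mixed_prod l' y.
Proof.
move=> /subnKC <-; elim: (l' - l)%N => [|k IH]; first by rewrite addn0.
move=> /IH H; rewrite addnS -[y]mul1g.
have := mixed_prodS 1%g normal1 H.
by rewrite !gsimp.
Qed.

Lemma mixed_prodJ h l y : mixed_prod l y -> mixed_prod l (y ^ h)%g.
Proof.
elim=> [|{}l g x {}y Nx _ IH]; first by rewrite conj1g; exact: mixed_prod0.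
by rewrite !conjMg !conjVg; apply: mixed_prodS => //; exact: normalJ.
Qed.

(* [g, x]^-1 = [g^-1, g x g^-1] *)
Lemma mixed_prodV l y : mixed_prod l y -> mixed_prod l y^-1%g.
Proof.
elim=> [|{}l g x {}y Nx _ IH]; first by rewrite invg1; exact: mixed_prod0.
rewrite invgM -addn1; apply: mixed_prodD => //.
have /(mixed_prod_comm g^-1) : N (x ^ g^-1)%g by exact: normalJ.
by rewrite !conjgE !gnorm.
Qed.

(** Distance at most [l] in the word metric of mixed commutators. Conjugates of mixed commutators
    are again mixed commutators, so this metric is bi-invariant. *)
Definition near_comm l u v := mixed_prod l (u * v^-1)%g.

Lemma near_comm_refl u : near_comm 0 u u.
Proof. by rewrite /near_comm mulgV; exact: mixed_prod0. Qed.

Lemma near_comm_sym l u v : near_comm l u v -> near_comm l v u.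
Proof. by move=> /mixed_prodV; rewrite invgM invgK. Qed.

Lemma near_comm_trans v l l' u w :
  near_comm l u v -> near_comm l' v w -> near_comm (l + l') u w.
Proof.
move=> H H'; have := mixed_prodD H H'.
by rewrite /near_comm !gnorm.
Qed.

(** The quotient of [u * u'] by [v * v'] is the conjugate of [u' * v'^-1] by [u^-1], times
    [u * v^-1]. *)
Lemma near_commM l l' u v u' v' : near_comm l u v -> near_comm l' u' v' ->
  near_comm (l + l') (u * u')%g (v * v')%g.
Proof.
move=> H /(mixed_prodJ u^-1) H'; rewrite addnC.
by have := mixed_prodD H' H; rewrite /near_comm conjgE !gnorm.
Qed.

Lemma near_commV l u v : near_comm l u v -> near_comm l u^-1%g v^-1%g.
Proof.
move=> /near_comm_sym/(mixed_prodJ u); rewrite /near_comm conjgE.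
by rewrite !gnorm.
Qed.

Lemma near_comm_leq l l' u v : (l <= l')%N -> near_comm l u v ->
  near_comm l' u v.
Proof. exact: mixed_prod_leq. Qed.

Lemma near_commC g x : N x -> near_comm 1 (g * x)%g (x * g)%g.
Proof. by move=> /(mixed_prod_comm g); rewrite /near_comm invgM !mulgA. Qed.

Lemma near_commJ g x : N x -> near_comm 1 (x ^ g)%g x.
Proof.
by move=> /(mixed_prod_comm g^-1%g); rewrite /near_comm conjgE invgK !mulgA.
Qed.

Lemma mixed_prod_near l l' u v :
  near_comm l u v -> mixed_prod l' v -> mixed_prod (l + l') u.
Proof. by move=> H H'; have := mixed_prodD H H'; rewrite !gnorm. Qed.

Lemma near_comm_prod (I : eqType) (s : seq I) (f f' : I -> G) c :
  {in s, forall i, near_comm c (f i) (f' i)} ->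
  near_comm (c * size s) (\prod_(i <- s) f i)%g (\prod_(i <- s) f' i)%g.
Proof.
elim: s => [|i s IH] Hf; first by rewrite muln0 !big_nil; exact: near_comm_refl.
rewrite !big_cons /= mulnS; apply: near_commM; first by apply: Hf;
  rewrite mem_head.
by apply: IH => j js; apply: Hf; rewrite inE js orbT.
Qed.

(** Each [f' i], which lies in [N], moves past the product of the remaining [f j] at the price of
    one commutator. *)
Lemma near_comm_prodM (I : eqType) (s : seq I) (f f' : I -> G) :
  {in s, forall i, N (f' i)} ->
  near_comm (size s) (\prod_(i <- s) (f i * f' i))%g
    ((\prod_(i <- s) f i) * (\prod_(i <- s) f' i))%g.
Proof.
elim: s => [|i s IH] Nf.
  by rewrite !big_nil mulg1; exact: near_comm_refl.
have Nf's : {in s, forall j, N (f' j)}.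
  by move=> j js; apply: Nf; rewrite inE js orbT.
rewrite !big_cons /= -addn1.
apply: (@near_comm_trans (f i * f' i * ((\prod_(j <- s) f j) * (\prod_(j <- s)
  f' j)))%g).
  by rewrite -[X in near_comm X]add0n; apply: near_commM;
    [exact: near_comm_refl|exact: IH].
have Nf'i : N (f' i) by apply: Nf; rewrite mem_head.
have := near_commM (near_commM (near_comm_refl (f i))
  (near_comm_sym (near_commC (\prod_(j <- s) f j)%g Nf'i)))
  (near_comm_refl (\prod_(j <- s) f' j)%g).
by rewrite !mulgA.
Qed.

Lemma near_comm_perm (I : eqType) (s s' : seq I) (f : I -> G) :
  {in s, forall i, N (f i)} -> perm_eq s s' ->
  near_comm (size s) (\prod_(i <- s) f i)%g (\prod_(i <- s') f i)%g.
Proof.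
elim: s => [|i s IH] in s' * => Nf.
  by rewrite perm_sym => /perm_nilP ->; exact: near_comm_refl.
move=> ss'.
have is' : i \in s' by rewrite -(perm_mem ss') mem_head.
case/splitPr: is' ss' => s1 s2.
rewrite perm_sym -cat1s perm_catCA /= perm_cons perm_sym => ss'.
rewrite big_cons big_cat /= big_cons -addn1.
apply: (@near_comm_trans (f i * (\prod_(j <- s1 ++ s2) f j))%g).
  rewrite -[X in near_comm X]add0n; apply: near_commM;
    first exact: near_comm_refl.
  by apply: IH => // j js; apply: Nf; rewrite inE js orbT.
rewrite big_cat /= !mulgA -[1%N]addn0; apply: near_commM;
  last exact: near_comm_refl.
by apply: near_comm_sym; apply: near_commC; apply: Nf; rewrite mem_head.
Qed.

(** The inverses stand in the same order as the factors, so cancelling them costs one commutator per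
    factor. *)
Lemma near_comm_prodV (I : eqType) (s : seq I) (f : I -> G) :
  {in s, forall i, N (f i)} ->
  near_comm (size s) (\prod_(i <- s) f i * \prod_(i <- s) (f i)^-1)%g 1%g.
Proof.
move=> Nf; apply: near_comm_sym.
rewrite [X in near_comm _ X](_ : _ = \prod_(i <- s) (f i * (f i)^-1))%g.
  by apply: near_comm_prodM => i si; apply/normalV/Nf.
by rewrite big1 // => i _; rewrite mulgV.
Qed.

End NormalSubgroup.
Arguments mixed_prod {G} N l y.
Arguments near_comm {G} N l u v.

Lemma normal_subgroupT (G : groupType) : normal_subgroup [set: G].
Proof. by split=> //; split=> [|x y _ _]; exact/mem_set. Qed.

(** * Existence of the limit defining scl *)

Lemma ereal_inf_nat (R : realType) (S : set nat) : S !=set0 ->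
  exists l, [/\ S l, forall l', S l' -> (l <= l')%N &
    ereal_inf [set l%:R%:E | l in S] = l%:R%:E :> \bar R].
Proof.
move=> [l0 Sl0].
have exS : exists l, `[< S l >] by exists l0; apply/asboolP.
case: (ex_minnP exS) => l /asboolP Sl lmin; exists l.
have lmin' l' : S l' -> (l <= l')%N by move=> Sl'; apply/lmin/asboolP.
split=> //; apply/eqP; rewrite eq_le; apply/andP; split.
  by apply: ereal_inf_lbound; exists l.
by apply/ereal_infP => _ [l' Sl' <-]; rewrite lee_fin ler_nat lmin'.
Qed.

(** Fekete's lemma for sequences that are subadditive up to a constant. *)
Lemma fekete (R : realType) (a : nat -> nat) (C : nat) :
  (forall j k, a (j + k) <= a j + a k + C)%N ->
  cvgn (fun k => k%:R^-1 * (a k)%:R : R).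
Proof.
(* Adding [C] makes the sequence subadditive and changes the quotient by [k] only by [C / k]. *)
move=> suba; pose b k := (a k + C)%N.
have subb j k : (b (j + k) <= b j + b k)%N by rewrite /b; have := suba j k; lia.
have subbM p r q : (b (q * p + r) <= q * b p + b r)%N.
  elim: q => [|q IH]; first by rewrite !mul0n !add0n.
  rewrite !mulSn -addnA; apply: leq_trans (subb _ _) _.
  by rewrite -addnA leq_add2l.
pose S : set R := [set (b k)%:R / k%:R | k in [set k | (0 < k)%N]].
have infS : has_inf S.
  split; first by exists ((b 1)%:R / 1%:R), 1%N.
  by exists 0 => _ [k _ <-]; rewrite divr_ge0.
apply/cvg_ex; exists (inf S); apply/cvgrPdist_le => e e0.
have e20 : 0 < e / 2 by rewrite divr_gt0.
have [_ [p /= p0 <-] bp] := inf_adherent e20 infS.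
(* [M] bounds the contribution of the remainder of [n] modulo [p]; [n0] is so large that
   [(M + C) / n] is at most [e / 2] beyond it. *)
pose M := (\max_(r < p) b r)%N.
have [n0 Hn0] : exists n0 : nat, (M + C)%:R / (e / 2) < n0%:R.
  by exists (Num.truncn ((M + C)%:R / (e / 2))).+1; apply: truncnS_gt.
exists n0.+1 => // n /= nn0.
have n_gt0 : (0 < n)%N by apply: leq_trans nn0.
have nR0 : 0 < n%:R :> R by rewrite ltr0n.
have Mn : (M + C)%:R / n%:R <= e / 2.
  rewrite ler_pdivrMr // mulrC -ler_pdivrMr //.
  by apply: le_trans (ltW Hn0) _; rewrite ler_nat ltnW.
have lb : inf S <= (b n)%:R / n%:R by apply: ge_inf; [case: infS|exists n].
have bn : (b n <= n %/ p * b p + M)%N.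
  rewrite {1}(divn_eq n p); apply: leq_trans (subbM _ _ _) _.
  rewrite leq_add2l (leq_bigmax (Ordinal (ltn_pmod n p0))) //.
have ub : (b n)%:R / n%:R <= (b p)%:R / p%:R + M%:R / n%:R :> R.
  rewrite ler_pdivrMr // mulrDl mulfVK ?gt_eqF //.
  apply: (@le_trans _ _ ((n %/ p)%:R * (b p)%:R + M%:R)).
    by rewrite -natrM -natrD ler_nat.
  rewrite lerD2r mulrAC -mulrA mulrC ler_pM // ler_pdivlMr ?ltr0n //.
  by rewrite -natrM ler_nat leq_trunc_div.
have split_b : (b n)%:R / n%:R = n%:R^-1 * (a n)%:R + C%:R / n%:R :> R.
  by rewrite /b natrD mulrDl [_^-1 * _]mulrC.
rewrite natrD mulrDl in Mn.
have C0 : 0 <= C%:R / n%:R :> R by rewrite divr_ge0.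
have M0 : 0 <= M%:R / n%:R :> R by rewrite divr_ge0.
rewrite ler_norml; apply/andP; split; lra.
Qed.

Lemma size_index_ord k : size (index_enum 'I_k) = k.
Proof. by rewrite -[RHS]card_ord cardE enumT [index_enum _]unlock. Qed.

Section StableLength.
Context {R : realType} {G : groupType} {N : set G}.
Hypothesis nN : normal_subgroup N.

Lemma cl_le l y : mixed_prod N l y -> (cl R N y <= l%:R%:E)%E.
Proof. by move=> /(mixed_prodE nN) H; apply: ereal_inf_lbound; exists l. Qed.

Section Expression.
Context {m n : nat} (x : 'I_m -> G) (y : 'I_n -> G).
Hypotheses (Nx : forall i, N (x i)) (Ny : forall j, N (y j)).

(** The product without conjugation competes in the infimum, and undoing the conjugation of an
    optimal choice costs one commutator per factor. Hence [cl_expr] is the length of one fixed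
    product up to an error [m + n], which stabilization removes. *)
Lemma cl_expr_nat l : mixed_prod N l (\prod_(i < m) x i * \prod_(j < n) (y
  j)^-1)%g ->
  exists a, [/\ cl_expr R N x y = a%:R%:E,
   mixed_prod N (a + (m + n)) (\prod_(i < m) x i * \prod_(j < n) (y j)^-1)%g &
   forall l', mixed_prod N l' (\prod_(i < m) x i * \prod_(j < n) (y j)^-1)%g ->
     (a <= l')%N].
Proof.
move=> Hl.
pose T (g : 'I_m -> G) (h : 'I_n -> G) :=
  (\prod_(i < m) (x i ^ g i) * \prod_(j < n) (y j ^ h j)^-1)%g.
pose S := [set l | exists g h, mixed_prod N l (T g h)].
have T1 : T (fun=> 1%g) (fun=> 1%g) = (\prod_(i < m) x i * \prod_(j < n) (y
  j)^-1)%g.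
  by congr (_ * _)%g; apply: eq_bigr => i _; rewrite conjg1.
have S0 : S !=set0 by exists l, (fun=> 1%g), (fun=> 1%g); rewrite T1.
have [a [[g [h Ha]] amin _]] := ereal_inf_nat R S0.
exists a; split=> [||l' Hl'].
- apply/eqP; rewrite eq_le; apply/andP; split.
    apply: le_trans (cl_le Ha).
    by apply: ereal_inf_lbound; exists g, h.
  apply/ereal_infP => _ [g' [h' ->]].
  apply/ereal_infP => _ [l' /(mixed_prodE nN) Hl' <-].
  by rewrite lee_fin ler_nat; apply: amin; exists g', h'.
- rewrite addnC; apply: mixed_prod_near Ha; apply: (near_comm_sym nN).
  apply: (@near_comm_leq _ _ nN
    (1 * size (index_enum 'I_m) + 1 * size (index_enum 'I_n))).
    by rewrite !mul1n !size_index_ord.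
  apply: (near_commM nN); apply: (near_comm_prod nN) => i _.
    exact: near_commJ.
  by apply: (near_commV nN); exact: near_commJ.
- by apply: amin; exists (fun=> 1%g), (fun=> 1%g); rewrite T1.
Qed.

End Expression.

Section StableExpression.
Context {m n : nat} (x : 'I_m -> G) (y : 'I_n -> G).
Hypotheses (Nx : forall i, N (x i)) (Ny : forall j, N (y j)).

Definition expr_power k := (\prod_(i < m) (x i ^+ k) * \prod_(j < n) (y j ^-
  k))%g.

(** [m] commutators split the powers of the [x i], [n] those of the [y j], and one more exchanges
    the two middle products. *)
Lemma near_expr_powerD j k :
  near_comm N (m + n + 1) (expr_power (j + k)) (expr_power j * expr_power k)%g.
Proof.
pose X k := (\prod_(i < m) (x i ^+ k))%g;
  pose Y k := (\prod_(i < n) (y i ^- k))%g.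
have hX : near_comm N m (X (j + k)%N) (X j * X k)%g.
  rewrite -[m in near_comm N m]size_index_ord.
  rewrite /X; under eq_bigr do rewrite expgnDr.
  by apply: (near_comm_prodM nN) => i _; exact: normalX.
have hY : near_comm N n (Y (j + k)%N) (Y j * Y k)%g.
  rewrite -[n in near_comm N n]size_index_ord addnC.
  rewrite /Y; under eq_bigr do rewrite expgnDr invgM.
  by apply: (near_comm_prodM nN) => i _; apply/(normalV nN)/normalX.
apply: near_comm_trans (near_commM nN hX hY) _.
have NXk : N (X k) by apply: (normal_prod nN) => i _; exact: normalX.
have := near_commM nN (near_commM nN (@near_comm_refl _ N (X j))
  (near_comm_sym nN (near_commC (Y j) NXk))) (@near_comm_refl _ N (Y k)).
by rewrite /expr_power -/(X j) -/(X k) -/(Y j) -/(Y k) !mulgA.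
Qed.

Lemma expr_power_mixed_prod l k : mixed_prod N l (expr_power 1) ->
  exists l', mixed_prod N l' (expr_power k).
Proof.
move=> H1; elim: k => [|k [l' Hk]].
  exists 0%N; rewrite /expr_power !big1 ?mulg1 => [|i _|i _];
    rewrite ?expg0 ?invg1 //.
  exact: mixed_prod0.
rewrite -add1n; exists (m + n + 1 + (l + l'))%N.
by apply: mixed_prod_near (near_expr_powerD 1 k) _; exact: mixed_prodD.
Qed.

Lemma scl_expr_cvg l : mixed_prod N l (expr_power 1) ->
  exists (a : nat -> nat) (L : R), [/\
    (fun k => k%:R^-1 * (a k)%:R : R) @ \oo --> L, scl_expr R N x y = L%:E,
    forall k, mixed_prod N (a k + (m + n)) (expr_power k) &
    forall k l', mixed_prod N l' (expr_power k) -> (a k <= l')%N].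
Proof.
move=> H1.
have /choice[a Ha] k : exists a,
    [/\ cl_expr R N (fun i => x i ^+ k)%g (fun j => y j ^+ k)%g = a%:R%:E,
     mixed_prod N (a + (m + n)) (expr_power k) &
     forall l', mixed_prod N l' (expr_power k) -> (a <= l')%N].
  have [l' Hl'] := expr_power_mixed_prod k H1.
  by apply: cl_expr_nat Hl' => i; exact: normalX.
(* The constant is [m + n + 1] from [near_expr_powerD], plus [m + n] for dropping the conjugations
   at each of the exponents [j] and [k]. *)
have aD j k : (a (j + k) <= a j + a k + (m + n + 1 + 2 * (m + n)))%N.
  have [[[_ Hj _] [_ Hk _]] [_ _ Hjk]] := (Ha j, Ha k, Ha (j + k)%N).
  apply: Hjk.
  have := mixed_prod_near (near_expr_powerD j k) (mixed_prodD Hj Hk).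
  by apply: (mixed_prod_leq nN); lia.
have /cvg_ex[L La] := @fekete R _ _ aD.
exists a, L; split=> // [|k|k]; [|by case: (Ha k)..].
rewrite /scl_expr.
rewrite (_ : (fun k : nat => _) = EFin \o (fun k => k%:R^-1 * (a k)%:R));
  last first.
  by apply/funext => k /=; have [-> _ _] := Ha k.
by apply/cvg_lim => //; apply: cvg_EFin => //; near=> k.
Unshelve. all: by end_near. Qed.

End StableExpression.
End StableLength.

(** * Chains and boundaries *)

Section FreeChains.
Context {G : groupType}.

Lemma coeff_ext (K : nzRingType) (T : choiceType) (c d : {freeg T / K}) :
  (forall x, coeff x c = coeff x d) -> c = d.
Proof. by move=> cd; apply/eqP/freeg_eqP. Qed.

Lemma scale_freegU (K : nzRingType) (T : choiceType) (a k : K) (x : T) :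
  a *: << k *g x >> = << a * k *g x >>.
Proof. by apply: coeff_ext => y; rewrite coeffZ !coeffU mulrA. Qed.

Lemma boundaryU (K : nzRingType) (p : G * G) :
  boundary << p >> = << p.2 >> - << (p.1 * p.2)%g >> + << p.1 >> :> {freeg G /
    K}.
Proof. by rewrite /boundary liftU scale1r. Qed.

HB.instance Definition _ (K : nzRingType) :=
  GRing.isZmodMorphism.Build {freeg (G * G)%type / K} {freeg G / K} (@boundary
    K G)
    (lift_is_additive _).

Lemma boundaryZ (K : nzRingType) a (e : {freeg (G * G)%type / K}) :
  boundary (a *: e) = a *: boundary e.
Proof.
rewrite -[e]freeg_sumE scaler_sumr !(raddf_sum (@boundary K G)) scaler_sumr /=.
by apply: eq_bigr => p _; rewrite scale_freegU /boundary !liftU scalerA.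
Qed.

Lemma C2'_ind (K : nzRingType) (N : set G) (P : {freeg (G * G)%type / K} ->
  Prop) :
  P 0 -> (forall e f, P e -> P f -> P (e + f)) -> (forall a e, P e ->
    P (a *: e)) ->
  (forall p, N p.1 \/ N p.2 -> P << p >>) -> forall e, C2' N e -> P e.
Proof.
move=> P0 PD PZ PU e; apply; split.
  split; first exact/mem_set.
  by move=> a u v /set_mem Pu /set_mem Pv; apply/mem_set/PD => //; exact: PZ.
by move=> _ [p Np <-]; exact: PU.
Qed.

Lemma C2'_submod (K : nzRingType) (N : set G) : submod_closed [in @C2' K G N].
Proof.
split; first by apply/mem_set => S [[S0 _] _]; exact/set_mem.
move=> a u v /set_mem Cu /set_mem Cv; apply/mem_set => S SP.
have [[_ Sl] _] := SP.
by apply/set_mem/Sl; apply/mem_set; [exact: Cu|exact: Cv].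
Qed.

Lemma mixed_boundaries0 (K : nzRingType) (N : set G) :
  mixed_boundaries N (0 : {freeg G / K}).
Proof.
split; first by move=> x; rewrite dom0.
by exists 0; [case: (@C2'_submod K N) => /set_mem|exact: raddf0].
Qed.

Lemma mixed_boundariesD (K : nzRingType) (N : set G) (c d : {freeg G / K}) :
  mixed_boundaries N c -> mixed_boundaries N d -> mixed_boundaries N (c + d).
Proof.
move=> [Nc [e Ce ec]] [Nd [f Cf fd]]; split.
  by move=> x /domD_subset; rewrite mem_cat => /orP[/Nc|/Nd].
exists (e + f); last by rewrite raddfD /= ec fd.
have [_ Cl] := @C2'_submod K N.
by rewrite -[e]scale1r; apply/set_mem/Cl; exact/mem_set.
Qed.

Lemma mixed_boundariesZ (K : nzRingType) (N : set G) a (c : {freeg G / K}) :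
  mixed_boundaries N c -> mixed_boundaries N (a *: c).
Proof.
move=> [Nc [e Ce ec]]; split; first by move=> x /domZ_subset /Nc.
exists (a *: e); last by rewrite boundaryZ ec.
have [C0 Cl] := @C2'_submod K N.
by rewrite -[_ *: e]addr0; apply/set_mem/Cl => //; exact/mem_set.
Qed.

Lemma mixed_boundariesB (K : nzRingType) (N : set G) (c d : {freeg G / K}) :
  mixed_boundaries N c -> mixed_boundaries N d -> mixed_boundaries N (c - d).
Proof.
by move=> Nc Nd; rewrite -scaleN1r; apply: mixed_boundariesD => //;
  exact: mixed_boundariesZ.
Qed.

Lemma C2'U (K : nzRingType) (N : set G) (p : G * G) : N p.1 \/ N p.2 ->
  C2' N (<< p >> : {freeg (G * G)%type / K}).
Proof. by move=> Np S [_]; apply; exists p. Qed.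

Lemma mixed_boundariesU (K : nzRingType) (N : set G) (g h : G) :
  normal_subgroup N -> N g -> N h ->
  mixed_boundaries N (<< h >> - << (g * h)%g >> + << g >> : {freeg G / K}).
Proof.
move=> nN Ng Nh; split; last first.
  by exists << (g, h) >>; [apply: C2'U; left|exact: boundaryU].
have inU x y : x \in dom (<< y >> : {freeg G / K}) -> N y -> N x.
  by rewrite domU1 inE => /eqP ->.
move=> x /domD_subset; rewrite mem_cat => /orP[|/inU]; last exact.
move=> /domB; rewrite mem_cat => /orP[/inU|/inU]; apply => //.
exact: normalM.
Qed.

Lemma mixed_boundariesJ (K : nzRingType) (N : set G) (g x : G) :
  normal_subgroup N -> N x -> mixed_boundaries N (<< (x ^ g)%g >> - << x >> :
    {freeg G / K}).
Proof.
move=> nN Nx; have NJ := normalJ nN g Nx; split.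
  by move=> y /domB; rewrite mem_cat !domU1 !inE => /orP[] /eqP ->.
(* Since [g * x ^ g = x * g], the product terms of the two boundaries cancel, as do the terms
   [g]. *)
exists (<< (g, x ^ g)%g >> - << (x, g) >>).
  have [_ Cl] := @C2'_submod K N.
  have Cxg : C2' N (<< (x, g) >> : {freeg (G * G)%type / K}) by apply: C2'U;
    left.
  have Cgx : C2' N (<< (g, x ^ g)%g >> :
    {freeg (G * G)%type / K}) by apply: C2'U; right.
  by rewrite addrC -scaleN1r; apply/set_mem/Cl; exact/mem_set.
rewrite raddfB /= !boundaryU /= (conjgC x g) opprD addrA.
by rewrite -[_ - _ + << g >>]addrA [- _ + << g >>]addrC addrK.
Qed.

(** Lists carry both a positive chain and an ordered product in [G]; by [perm_seq_chain] the chain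
    determines the list up to permutation. *)
Definition seq_chain (s : seq G) : {freeg G / int} := \sum_(x <- s) << x >>.

Lemma seq_chain_cat s t : seq_chain (s ++ t) = seq_chain s + seq_chain t.
Proof. exact: big_cat. Qed.

Lemma coeff_seq_chain s x : coeff x (seq_chain s) = count_mem x s.
Proof.
elim: s => [|y s IH]; first by rewrite /seq_chain big_nil coeff0.
by rewrite /seq_chain big_cons coeffD coeffU mul1r IH /= PoszD natz.
Qed.

Lemma perm_seq_chain s t : seq_chain s = seq_chain t -> perm_eq s t.
Proof.
move=> st; apply/allP => x _ /=; apply/eqP.
by have := congr1 (coeff x) st; rewrite !coeff_seq_chain => -[].
Qed.

Lemma seq_chain_nseq k x : seq_chain (nseq k x) = << k%:Z *g x >>.
Proof.
by rewrite /seq_chain big_nseq iter_addr_0 freegU_muln natz.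
Qed.

Lemma seq_chain_expr (z : {freeg G / int}) : exists s t,
  z = seq_chain s - seq_chain t.
Proof.
rewrite -[z]freeg_sumE; elim: (dom z) => [|x r [s [t IH]]].
  by exists [::], [::]; rewrite /seq_chain !big_nil subr0.
rewrite big_cons IH; case: (coeff x z) => k.
  by exists (nseq k x ++ s), t; rewrite seq_chain_cat seq_chain_nseq addrA.
exists s, (nseq k.+1 x ++ t).
by rewrite seq_chain_cat seq_chain_nseq NegzE -freegUN opprD addrCA.
Qed.

Lemma seq_chain_codom m (x : 'I_m -> G) :
  seq_chain (map x (index_enum 'I_m)) = \sum_(i < m) << x i >>.
Proof. by rewrite /seq_chain big_map. Qed.

(* A signed sum of group elements [z] is tested on a sequence [F] of
   functions to [N]: the bound does not depend on the way [z] is written since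
   the factors commute up to one mixed commutator each. *)
Section Growth.
Context {N : set G}.
Hypothesis nN : normal_subgroup N.
Variable F : nat -> G -> G.
Hypothesis NF : forall j x, N (F j x).

(** What matters is the slope [c] in [j]. A constant [F] with slope 0 detects membership of products
    in [G,N]; the powers [x ^+ j] lead to bounds on scl. *)
Definition growth_le (c : nat) (z : {freeg G / int}) := exists s t,
  z = seq_chain s - seq_chain t /\ exists C, forall j,
    near_comm N (c * j + C) (\prod_(x <- s) F j x)%g (\prod_(x <- t) F j x)%g.

(** The lists [s ++ t'] and [s' ++ t] are permutations of each other. Reordering costs one
    commutator per element, exchanging the products over [t'] and [t] costs one more, and then the
    product over [t'] cancels. *)
Lemma growth_leP c z s t : growth_le c z -> z = seq_chain s - seq_chain t ->
  exists C, forall j,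
    near_comm N (c * j + C) (\prod_(x <- s) F j x)%g (\prod_(x <- t) F j x)%g.
Proof.
move=> [s' [t' [-> [C HC]]]] /eqP.
rewrite subr_eq addrAC eq_sym subr_eq -!seq_chain_cat => /eqP/perm_seq_chain st.
exists (size (s ++ t') + C + 1)%N => j.
have H1 : near_comm N (size (s ++ t')) (\prod_(x <- s ++ t') F j x)%g
    (\prod_(x <- s' ++ t) F j x)%g by apply: (near_comm_perm nN) => // x _.
rewrite !big_cat /= in H1.
have H2 := near_commM nN (HC j) (near_comm_refl (\prod_(x <- t) F j x)%g).
have H3 : near_comm N 1 ((\prod_(x <- t') F j x) * (\prod_(x <- t) F j x))%g
    ((\prod_(x <- t) F j x) * (\prod_(x <- t') F j x))%g.
  by apply: near_commC; apply: (normal_prod nN) => x _.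
have := near_comm_trans (near_comm_trans H1 H2) H3.
by rewrite /near_comm mulgKA addn0 addnCA !addnA.
Qed.

Lemma growth_le0 : growth_le 0 0.
Proof.
exists [::], [::]; rewrite subrr; split=> //; exists 0%N => j.
exact: near_comm_refl.
Qed.

Lemma growth_leD c c' z z' : growth_le c z -> growth_le c' z' ->
  growth_le (c + c') (z + z').
Proof.
move=> [s [t [-> [C HC]]]] [s' [t' [-> [C' HC']]]].
exists (s ++ s'), (t ++ t'); split;
  first by rewrite !seq_chain_cat opprD addrACA.
exists (C + C')%N => j; rewrite !big_cat /= mulnDl addnACA.
exact: near_commM.
Qed.

Lemma growth_leN c z : growth_le c z -> growth_le c (- z).
Proof.
move=> [s [t [-> [C HC]]]]; exists t, s; split; first by rewrite opprB.
by exists C => j; exact: near_comm_sym.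
Qed.

Lemma growth_leMn c z k : growth_le c z -> growth_le (c * k) (z *+ k).
Proof.
move=> cz; elim: k => [|k IH]; first by rewrite muln0; exact: growth_le0.
by rewrite mulnS mulrS; exact: growth_leD.
Qed.

Lemma growth_leZ c z (a : int) : growth_le c z -> growth_le (c * `|a|) (a *: z).
Proof.
rewrite -[a in a *: _]intz scaler_int => cz; case: a => k;
  first exact: growth_leMn.
by rewrite NegzE mulrNz abszN; apply: growth_leN; exact: growth_leMn.
Qed.

End Growth.

(** Dividing [g] on the left by a representative of its coset gN, chosen to be 1 for [N] itself,
    gives a retraction onto [N] that commutes with right translation by [N]. It allows the terms of
    a mixed boundary outside [N] to be tested inside [N]. *)
Lemma coset_translation (N : set G) : normal_subgroup N ->
  exists t : G -> G, [/\ forall g, N (t g), forall x, N x -> t x = x &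
    forall g x, N x -> t (g * x)%g = (t g * x)%g].
Proof.
move=> nN.
pose r g := if `[< N g >] then 1%g else xget 1%g [set h | N (h^-1 * g)%g].
exists (fun g => (r g)^-1 * g)%g; split=> [g|x Nx|g x Nx].
- rewrite /r; case: asboolP => [|_]; first by rewrite invg1 mul1g.
  by case: xgetP => [h -> //|/(_ g)[]]; rewrite /= mulVg; exact: normal1.
- by rewrite /r asboolT // invg1 mul1g.
rewrite mulgA; congr (_ ^-1 * _ * _)%g.
have NM y : N (y * x)%g = N y.
  apply/propext; split=> [Nyx|Ny]; last exact: normalM.
  by rewrite -[y](mulgK x); apply: normalM => //; exact: normalV.
(* [g] and [g * x] have the same set of candidate representatives, so [xget] makes the same choice
   for both. *)
rewrite /r NM; case: asboolP => // _; congr (xget _ _).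
by apply/funext => h /=; rewrite mulgA NM.
Qed.

(** After applying the retraction [t], the boundary of each generating pair becomes a relation that
    holds up to one mixed commutator. Summing these gives slope 0, so the product lies in [G,N] and
    the lengths defining scl are finite. *)
Lemma mixed_boundary_trivial (N : set G) m n (x : 'I_m -> G) (y : 'I_n -> G) :
  normal_subgroup N -> (forall i, N (x i)) -> (forall j, N (y j)) ->
  CZ N (\sum_(i < m) << x i >> - \sum_(j < n) << y j >>) ->
  exists l, mixed_prod N l (\prod_(i < m) x i * \prod_(j < n) (y j)^-1)%g.
Proof.
move=> nN Nx Ny [_ [e Ce ez]].
have [t [Nt tN tM]] := coset_translation nN.
have NF (j : nat) g : N (t g) by [].
have : growth_le (N := N) (fun=> t) 0 (boundary e).
  move: e Ce {ez}; apply: C2'_ind => [|e f||p Np].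
  - by rewrite raddf0; exact: growth_le0.
  - by move=> He Hf; rewrite raddfD; exact: (growth_leD nN He Hf).
  - by move=> a e He; rewrite boundaryZ; exact: (growth_leZ nN a He).
  rewrite boundaryU; exists [:: p.2; p.1], [:: (p.1 * p.2)%g]; split.
    by rewrite /seq_chain !big_cons !big_nil !addr0 addrAC.
  exists 1%N => j /=; rewrite !big_cons !big_nil !mulg1 mul0n add0n.
  case: Np => Np.
    rewrite (conjgC p.1) tM ?[t p.1]tN //; last exact: normalJ.
    apply: (near_commM nN (near_comm_refl (t p.2))).
    by apply: (near_comm_sym nN); exact: near_commJ.
  by rewrite tM ?[t p.2]tN //; apply: (near_comm_sym nN); exact: near_commC.
rewrite ez -!seq_chain_codom => Hg.
have [C /(_ 0%N)] := growth_leP nN NF Hg erefl.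
rewrite !big_map (eq_bigr x) => [|i _]; last exact: tN.
rewrite [X in near_comm _ _ _ X](eq_bigr y) => [|i _]; last exact: tN.
rewrite mul0n add0n => H.
have H2 := near_commM nN H (near_comm_refl (\prod_(j < n) (y j)^-1)%g).
have := near_comm_trans H2 (near_comm_prodV nN (fun j _ => Ny j)).
by rewrite /near_comm divg1; eexists; eassumption.
Qed.
End FreeChains.

(** A bounded error disappears after division by [j]; every passage to stable quantities below uses
    this. *)
Lemma cvgn_ratio_ge (R : realType) (v : nat -> R) (V T C : R) :
  v @ \oo --> V -> (forall j : nat, j%:R * T <= j%:R * v j + C) -> T <= V.
Proof.
move=> vV H; rewrite leNgt; apply/negP => VT.
have e0 : 0 < (T - V) / 2 by rewrite divr_gt0 // subr_gt0.
have [n0 _ Hn0] : \forall k \near \oo, v k < V + (T - V) / 2.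
  by apply: cvgr_lt vV _ _; rewrite ltrDl.
pose j := maxn n0 (Num.truncn (C / ((T - V) / 2))).+1.
have jC : C < j%:R * ((T - V) / 2).
  rewrite -ltr_pdivrMr //; apply: lt_le_trans (truncnS_gt _) _.
  by rewrite ler_nat leq_maxr.
have := Hn0 j (leq_maxl _ _) => /= vj.
have : j%:R * v j <= j%:R * (V + (T - V) / 2) by rewrite ler_wpM2l // ltW.
by have := H j; lra.
Qed.

(** * Evaluation of functions on rational chains *)

Section ChainEval.
Context {R : realType} {G : groupType}.
Implicit Types (mu : G -> R) (c d : {freeg G / rat}).

Lemma chain_eval_sub mu c (s : seq G) : uniq s -> {subset dom c <= s} ->
  chain_eval mu c = \sum_(x <- s) ratr (coeff x c) * mu x.
Proof.
move=> us cs; rewrite /chain_eval [RHS](bigID (mem (dom c)) predT) /= [X in _ +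
  X]big1 ?addr0.
  rewrite -[RHS]big_filter; apply: perm_big; apply: uniq_perm.
  - exact: uniq_dom.
  - exact: filter_uniq.
  - by move=> x; rewrite mem_filter; case: (boolP (x \in dom c)) => // /cs.
by move=> x /coeff_outdom ->; rewrite rmorph0 mul0r.
Qed.

Lemma chain_evalD mu c d : chain_eval mu (c + d) = chain_eval mu c + chain_eval
  mu d.
Proof.
pose s := undup (dom c ++ dom d).
rewrite !(@chain_eval_sub mu _ s) ?undup_uniq //.
- by rewrite -big_split; apply: eq_bigr => x _ /=;
  rewrite coeffD rmorphD mulrDl.
- by move=> x xd; rewrite mem_undup mem_cat xd orbT.
- by move=> x xd; rewrite mem_undup mem_cat xd.
- by move=> x /domD_subset; rewrite mem_undup.
Qed.

Lemma chain_evalZ mu a c : chain_eval mu (a *: c) = ratr a * chain_eval mu c.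
Proof.
rewrite (@chain_eval_sub mu (a *: c) (dom c)) ?uniq_dom //;
  last exact: domZ_subset.
by rewrite /chain_eval mulr_sumr; apply: eq_bigr => x _;
  rewrite coeffZ rmorphM mulrA.
Qed.

Lemma chain_evalN mu c : chain_eval mu (- c) = - chain_eval mu c.
Proof. by rewrite -scaleN1r chain_evalZ rmorphN1 mulN1r. Qed.

Lemma chain_evalB mu c d : chain_eval mu (c - d) = chain_eval mu c - chain_eval
  mu d.
Proof. by rewrite chain_evalD chain_evalN. Qed.

Lemma chain_eval0 mu : chain_eval mu 0 = 0.
Proof. by rewrite /chain_eval dom0 big_nil. Qed.

Lemma chain_evalU mu x : chain_eval mu << x >> = mu x.
Proof. by rewrite /chain_eval domU1 big_seq1 coeffU eqxx mulr1 rmorph1 mul1r.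
  Qed.

Lemma eq_chain_eval mu mu' c : {in dom c, mu =1 mu'} ->
  chain_eval mu c = chain_eval mu' c.
Proof.
by move=> e; rewrite /chain_eval !big_seq; apply: eq_bigr => x xc; rewrite e.
Qed.

Lemma chain_evalDl mu mu' c :
  chain_eval (fun x => mu x + mu' x) c = chain_eval mu c + chain_eval mu' c.
Proof. by rewrite /chain_eval -big_split; apply: eq_bigr => x _;
  rewrite mulrDr. Qed.

Lemma coeff_chain_intr (z : {freeg G / int}) x :
  coeff x (chain_intr z) = (coeff x z)%:~R.
Proof.
rewrite -[in RHS](freeg_sumE z) /chain_intr !raddf_sum /=.
by apply: eq_bigr => y _; rewrite !coeffU rmorphM; case: eqP.
Qed.

Lemma chain_intr_inj : injective (@chain_intr G).
Proof.
move=> z w zw; apply: coeff_ext => x.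
by have := congr1 (coeff x) zw; rewrite !coeff_chain_intr => /intr_inj.
Qed.

Lemma chain_intrD (z w : {freeg G / int}) :
  chain_intr (z + w) = chain_intr z + chain_intr w.
Proof. by apply: coeff_ext => x; rewrite coeffD !coeff_chain_intr coeffD
  rmorphD. Qed.

Lemma chain_intrZ a (z : {freeg G / int}) :
  chain_intr (a *: z) = a%:~R *: chain_intr z.
Proof. by apply: coeff_ext => x; rewrite coeffZ !coeff_chain_intr coeffZ
  rmorphM. Qed.

Lemma chain_intr0 : chain_intr (0 : {freeg G / int}) = 0.
Proof. by apply: coeff_ext => x; rewrite coeff_chain_intr !coeff0. Qed.

Lemma chain_intrN (z : {freeg G / int}) : chain_intr (- z) = - chain_intr z.
Proof. by apply: coeff_ext => x; rewrite coeffN !coeff_chain_intr coeffN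
  rmorphN. Qed.

Lemma chain_intrU x : chain_intr (<< x >> : {freeg G / int}) = << x >>.
Proof. by apply: coeff_ext => y; rewrite coeff_chain_intr !coeffU !mul1r;
  case: eqP. Qed.

Lemma chain_eval_seq mu (s : seq G) :
  chain_eval mu (chain_intr (seq_chain s)) = \sum_(x <- s) mu x.
Proof.
elim: s => [|x s IH]; first by rewrite /seq_chain !big_nil chain_intr0
  chain_eval0.
by rewrite -cat1s seq_chain_cat chain_intrD chain_evalD IH big_cons /seq_chain
  big_seq1 chain_intrU chain_evalU.
Qed.

End ChainEval.

(** * Quasimorphisms bound scl from below *)

Section Quasimorphism.
Context {R : realType} {G : groupType} {N : set G}.
Implicit Types mu : G -> R.

Lemma quasimorphismP mu : quasimorphism N mu <->
  exists2 D : R, 0 <= D & forall x y, N x -> N y ->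
    `|mu (x * y)%g - mu x - mu y| <= D.
Proof.
split=> [|[D D0 HD]]; last first.
  apply: (@le_lt_trans _ _ D%:E); last exact: ltry.
  by apply/ereal_supP => _ [x [y [Nx Ny ->]]]; rewrite lee_fin HD.
have le x y : N x -> N y -> (`|mu (x * y)%g - mu x - mu y|%:E <= defect N mu)%E.
  by move=> Nx Ny; apply: ereal_sup_ubound; exists x, y.
rewrite /quasimorphism; case: (defect N mu) le => [r| |] // le _.
  exists (Num.max 0 r) => [|x y Nx Ny]; rewrite le_max ?lexx //.
  by apply/orP; right; rewrite -lee_fin le.
(* A defect equal to -oo leaves no pair in [N] to be bounded. *)
by exists 0 => // x y Nx Ny; have := le x y Nx Ny.
Qed.

Lemma homogeneousX mu x k : homogeneous N mu -> N x ->
  mu (x ^+ k)%g = k%:R * mu x.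
Proof.
move=> homo Nx; elim: k => [|k IH].
  rewrite mul0r; have := homo x Nx 1%g 1%g; rewrite mulg1.
  have cyc1 : cyclic_subgroup x 1%g by exists 0%N; left.
  by move=> /(_ cyc1 cyc1); lra.
rewrite expgS (homo x Nx) ?IH; first by rewrite -natr1; lra.
- by exists 1%N; left; rewrite expg1.
- by exists k; left.
Qed.

Lemma homogeneousV mu x : homogeneous N mu -> N x -> mu x^-1%g = - mu x.
Proof.
move=> homo Nx; have := homo x Nx x x^-1%g.
rewrite mulgV -(expg0 x) homogeneousX // mul0r => H.
by apply/eqP; rewrite -addr_eq0 addrC -H //; [exists 1%N; left;
  rewrite expg1|exists 1%N; right; rewrite expg1].
Qed.

Section Bavard.
Hypothesis nN : normal_subgroup N.
Variables (mu : G -> R) (D : R).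
Hypotheses (D0 : 0 <= D) (muinv : Q_inv N mu).
Hypothesis HD : forall x y, N x -> N y -> `|mu (x * y)%g - mu x - mu y| <= D.

Lemma quasimorphism_prod (I : eqType) (s : seq I) (f : I -> G) :
  {in s, forall i, N (f i)} ->
  `|mu (\prod_(i <- s) f i)%g - \sum_(i <- s) mu (f i)| <= D * (size s)%:R.
Proof.
have [[_ homo] _] := muinv.
elim: s => [|i s IH] Nf.
  by rewrite !big_nil mulr0 subr0 -(expg0 1%g) homogeneousX ?mul0r ?normr0 //;
    exact: normal1.
have Nfs : {in s, forall j, N (f j)} by move=> j js; apply: Nf;
  rewrite inE js orbT.
have Nfi : N (f i) by apply: Nf; rewrite mem_head.
have := IH Nfs; have := HD Nfi (normal_prod nN Nfs).
rewrite !big_cons /= -natr1 !ler_norml => /andP[? ?] /andP[? ?].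
by apply/andP; split; lra.
Qed.

Lemma mixed_prod_subset l y : mixed_prod N l y -> N y.
Proof.
elim=> [|{}l g x {}y Nx _ Ny]; first exact: normal1.
apply: (normalM nN) => //; apply: (normalM nN); last exact: normalV.
by have := normalJ nN g^-1%g Nx; rewrite conjgE invgK mulgA.
Qed.

(** By invariance the values at [g * x * g^-1] and [x^-1] cancel. Each commutator thus costs [D] to
    split it and [D] to separate it from the rest. *)
Lemma quasimorphism_mixed_prod l y : mixed_prod N l y ->
  `|mu y| <= 2 * D * l%:R.
Proof.
have [[_ homo] inv] := muinv.
elim=> [|{}l g x {}y Nx H IH].
  by rewrite mulr0 -(expg0 1%g) homogeneousX ?mul0r ?normr0 //; exact: normal1.
have Nxg : N (g * x * g^-1)%g.
  by have := normalJ nN g^-1%g Nx; rewrite conjgE invgK mulgA.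
have mxg : mu (g * x * g^-1)%g = mu x.
  by rewrite -(inv g^-1%g x Nx) conjgE invgK mulgA.
have := HD Nxg (normalV nN Nx); rewrite mxg (homogeneousV homo) //.
have := HD (normalM nN Nxg (normalV nN Nx)) (mixed_prod_subset H).
move: IH; rewrite -natr1 !ler_norml => /andP[? ?] /andP[? ?] /andP[? ?].
by apply/andP; split; lra.
Qed.

(** The easy half of Bavard duality: evaluate at [k]-th powers, where homogeneity multiplies the
    sums by [k], and let [k] grow. *)
Lemma scl_expr_ge m n (x : 'I_m -> G) (y : 'I_n -> G) r :
  (forall i, N (x i)) -> (forall j, N (y j)) ->
  CZ N (\sum_(i < m) << x i >> - \sum_(j < n) << y j >>) ->
  (scl_expr R N x y <= r%:E)%E ->
  `|\sum_(i < m) mu (x i) - \sum_(j < n) mu (y j)| <= 2 * D * r.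
Proof.
move=> Nx Ny /(mixed_boundary_trivial nN Nx Ny)[l Hl].
have [a [L [aL -> Ha _]]] := scl_expr_cvg (R := R) nN Nx Ny Hl.
rewrite lee_fin => Lr; apply: (@le_trans _ _ (2 * D * L)); last first.
  by rewrite ler_wpM2l // mulr_ge0.
set T := _ - _.
have [[_ homo] inv] := muinv.
have cv : (fun k : nat => 2 * D * (k%:R^-1 * (a k)%:R)) @ \oo --> 2 * D * L.
  by apply: cvgMr.
(* The first summand pays for the [m + n] commutators by which [cl_expr] and the fixed product may
   differ, the second for splitting that product into its factors. *)
apply: (cvgn_ratio_ge (C := 2 * D * (m + n)%:R + D * (m + n + 1)%:R)  cv) =>
  -[|k'].
  by rewrite !mul0r add0r addr_ge0 // !mulr_ge0.
set k := k'.+1; have k0 : k%:R != 0 :> R by rewrite pnatr_eq0.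
rewrite [k%:R * (2 * D * _)]mulrCA mulVKf //.
pose X := (\prod_(i < m) (x i ^+ k))%g; pose Y := (\prod_(j < n) (y j ^- k))%g.
have NX : N X by apply: (normal_prod nN) => i _; exact: normalX.
have NY : N Y by apply: (normal_prod nN) => j _; apply: (normalV nN);
  exact: normalX.
have hX : `|mu X - k%:R * \sum_(i < m) mu (x i)| <= D * m%:R.
  rewrite mulr_sumr (eq_bigr (fun i => mu (x i ^+ k)%g)) => [|i _];
    last by rewrite homogeneousX.
  rewrite -[X in D * X%:R]size_index_ord; apply: quasimorphism_prod => i _;
    exact: normalX.
have hY : `|mu Y + k%:R * \sum_(j < n) mu (y j)| <= D * n%:R.
  rewrite mulr_sumr -[X in _ + X]opprK -sumrN (eq_bigr (fun j => mu (y j ^-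
    k)%g)) => [|j _]; last first.
    by rewrite homogeneousV ?homogeneousX //; exact: normalX.
  rewrite -[X in D * X%:R]size_index_ord; apply: quasimorphism_prod => j _.
  by apply: (normalV nN); exact: normalX.
have := quasimorphism_mixed_prod (Ha k); have := HD NX NY.
rewrite -/(X * Y)%g; move: hX hY; rewrite /T.
set t := mu (X * Y)%g => hX hY hXY ht.
have {}hX : `|k%:R * (\sum_(i < m) mu (x i) - \sum_(j < n) mu (y j))| <=
    2 * D * (a k)%:R + 2 * D * (m + n)%:R + D * (m + n + 1)%:R.
  move: hX hY hXY ht; rewrite !natrD !ler_norml.
  move=> /andP[? ?] /andP[? ?] /andP[? ?] /andP[? ?].
  by apply/andP; split; lra.
by rewrite normrM ger0_norm // in hX; rewrite addrA.
Qed.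
End Bavard.
End Quasimorphism.

(** * Hahn-Banach over the rationals *)

Section HahnBanach.
Context {R : realType} {V : lmodType rat}.
(** A seminorm given through its upper bounds; a vector without any bound has seminorm +oo. *)
Variable bound : V -> R -> Prop.
Hypothesis bound0 : bound 0 0.
Hypothesis boundD : forall u v q r, bound u q -> bound v r ->
  bound (u + v) (q + r).
Hypothesis boundZ : forall a u q, 0 < a -> bound u q ->
  bound (a *: u) (ratr a * q).
Hypothesis boundN : forall u q, bound u q -> bound (- u) q.

(** Partial functionals as graphs, so that extension is inclusion and Zorn's lemma applies to sets.
    Single-valuedness follows from domination at 0. *)
Definition bounded_graph (X : set (V * R)) :=
  [/\ X (0, 0),
      forall u v y z, X (u, y) -> X (v, z) -> X (u + v, y + z),
      forall a u y, X (u, y) -> X (a *: u, ratr a * y) &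
      forall u y q, X (u, y) -> bound u q -> y <= q].

Lemma bounded_graph_extend X v : bounded_graph X ->
  exists2 Y, bounded_graph Y & X `<=` Y /\ exists y, Y (v, y).
Proof.
move=> [X0 XD XZ Xb].
have XN u y : X (u, y) -> X (- u, - y).
  by move=> /(XZ (-1)); rewrite scaleN1r rmorphN1 mulN1r.
(* [S] consists of the lower bounds imposed on the value at [v], which is taken to be [sup S]. By
   the symmetry [boundN], any single constraint makes [S] both nonempty and bounded above; if there
   is none, every value is admissible. *)
pose S : set R := [set r | exists u y q, [/\ X (u, y),
  bound (u - v) q & r = y - q]].
have SX u y q : X (u, y) -> bound (u + v) q -> ubound S (q - y).
  move=> Xu bu _ [u' [y' [q' [Xu' bu' ->]]]].
  have : bound (u + u') (q + q').
    by have := boundD bu bu'; rewrite addrACA subrr addr0.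
  by move=> /(Xb _ _ _ (XD _ _ _ _ Xu Xu')); lra.
have ub_al u y q : X (u, y) -> bound (u + v) q -> y + sup S <= q.
  move=> Xu bu; rewrite addrC -lerBrDr; apply: ge_sup; last exact: SX Xu bu.
  exists (- y - q); exists (- u), (- y), q; split => //; first exact: XN.
  by rewrite -opprD; exact: boundN.
have lb_al u y q : X (u, y) -> bound (u - v) q -> y - sup S <= q.
  move=> Xu bu; rewrite lerBlDr addrC -lerBlDr; apply: ub_le_sup;
    last by exists u, y, q.
  exists (q - - y); apply: (SX (- u)); first exact: XN.
  by rewrite -[v]opprK -opprD; exact: boundN.
exists [set p | exists u y a, X (u, y) /\ p = (u + a *: v, y + ratr a * sup S)].
  split.
  - by exists 0, 0, 0; split=> //; rewrite scale0r rmorph0 mul0r !addr0.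
  - move=> _ _ _ _ [u [y [a [Xu [-> ->]]]]] [u' [y' [a' [Xu' [-> ->]]]]].
    exists (u + u'), (y + y'), (a + a'); split; first exact: XD.
    by rewrite scalerDl rmorphD mulrDl addrACA [y + _ + _]addrACA.
  - move=> b _ _ [u [y [a [Xu [-> ->]]]]].
    exists (b *: u), (ratr b * y), (b * a); split; first exact: XZ.
    by rewrite scalerDr scalerA rmorphM mulrDr mulrA.
  move=> _ _ q [u [y [a [Xu [-> ->]]]]] bq.
  (* Dividing by the absolute value of [a] reduces to the coefficients 1 and -1 of [v]. *)
  have [a0|a0|a0] := ltrgtP a 0.
  - have b0 : 0 < - a^-1 by rewrite oppr_gt0 invr_lt0.
    have rb0 : 0 < ratr (- a^-1) :> R by rewrite ltr0q.
    have := boundZ b0 bq; rewrite scalerDr scalerA mulNr mulVf ?lt_eqF //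
      scaleN1r.
    move=> /(lb_al _ _ _ (XZ _ _ _ Xu)) H.
    rewrite -(ler_pM2l rb0) mulrDr mulrA -rmorphM mulNr mulVf ?lt_eqF //.
    by rewrite rmorphN1 mulN1r.
  - have b0 : 0 < a^-1 by rewrite invr_gt0.
    have rb0 : 0 < ratr a^-1 :> R by rewrite ltr0q.
    have := boundZ b0 bq; rewrite scalerDr scalerA mulVf ?gt_eqF // scale1r.
    move=> /(ub_al _ _ _ (XZ _ _ _ Xu)) H.
    rewrite -(ler_pM2l rb0) mulrDr mulrA -rmorphM mulVf ?gt_eqF //.
    by rewrite rmorph1 mul1r.
  - by move: bq; rewrite a0 scale0r rmorph0 mul0r !addr0; exact: Xb.
split=> [[u y] Xu|].
  by exists u, y, 0; split=> //; rewrite scale0r rmorph0 mul0r !addr0.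
by exists (sup S), 0, 0, 1; split=> //; rewrite scale1r rmorph1 mul1r !add0r.
Qed.

Lemma hahn_banach_rat X : bounded_graph X ->
  exists F : V -> R, [/\ forall u v, F (u + v) = F u + F v,
    forall u y, X (u, y) -> F u = y & forall u q, bound u q -> F u <= q].
Proof.
move=> bX.
(* The order is on sets [Y] whose union with [X] is a bounded graph, so that the empty chain has an
   admissible union. *)
have [F FX totF|A [bA Amax]] := @Zorn_bigcup (V * R)%type [set Y |
  bounded_graph (X `|` Y)].
  rewrite /=.
  have [->|/set0P[Y0 FY0]] := eqVneq F set0; first by rewrite bigcup_set0 setU0.
  have up Y : F Y -> X `|` Y `<=` X `|` \bigcup_(Z in F) Z.
    by move=> FY p [Xp|Yp]; [left|right; exists Y].
  have one p : (X `|` \bigcup_(Z in F) Z) p -> exists2 Y, F Y & (X `|` Y) p.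
    by move=> [Xp|[Y FY Yp]]; [exists Y0 => //; left|exists Y => //; right].
  split.
  - by apply: (up _ FY0); case: (FX _ FY0).
  - move=> u v y z /one[Y FY Yu] /one[Z FZ Zv].
    have [YZ|ZY] := totF _ _ FY FZ.
      apply: (up _ FZ); have [_ ZD _ _] := FX _ FZ; apply: ZD => //.
      by case: Yu => [?|/YZ]; [left|right].
    apply: (up _ FY); have [_ YD _ _] := FX _ FY; apply: YD => //.
    by case: Zv => [?|/ZY]; [left|right].
  - move=> a u y /one[Y FY Yu]; apply: (up _ FY).
    by have [_ _ YZ _] := FX _ FY; exact: YZ.
  - move=> u y q /one[Y FY Yu]; have [_ _ _ Yb] := FX _ FY; exact: Yb.
pose Y := X `|` A.
have totY v : exists y, Y (v, y).
  have [Z bZ [YZ [y Zv]]] := bounded_graph_extend v bA.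
  exists y; apply: contrapT => nY.
  apply: (Amax Z); last by rewrite /= setUidr // => p Xp; apply: YZ; left.
  split; first by move=> p Ap; apply: YZ; right.
  by move=> /(_ _ Zv) Av; apply: nY; right.
have [Y0 YD YZ Yb] := bA.
(* Domination applied to both [y] and [- y] at the vector 0. *)
have Y00 y : Y (0, y) -> y = 0.
  move=> Y0y; apply/eqP; rewrite eq_le (Yb _ _ _ Y0y bound0) /=.
  have := YZ (-1) _ _ Y0y; rewrite scaler0 rmorphN1 mulN1r => /Yb/(_ bound0).
  by rewrite oppr_le0.
have Yfun u y z : Y (u, y) -> Y (u, z) -> y = z.
  move=> Yy /(YZ (-1)); rewrite scaleN1r rmorphN1 mulN1r => /(YD _ _ _ _ Yy).
  by rewrite subrr => /Y00/eqP; rewrite subr_eq0 => /eqP.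
have [F FY] := choice totY.
exists F; split=> [u v|u y Xu|u q].
- exact: Yfun (FY _) (YD _ _ _ _ (FY u) (FY v)).
- by apply: Yfun (FY u) _; left.
- exact: Yb (FY u).
Qed.

End HahnBanach.

(** A finite upper bound rules out the default +oo of both uses of [xget], leaving a multiple of [c]
    and an expression of it to which [scl_expr_ge] applies; the constant is [2 * D]. *)
Lemma scl_ge (R : realType) (G : groupType) (N : set G) (mu : G -> R) :
  normal_subgroup N -> Q_inv N mu ->
  exists2 K : R, 0 <= K & forall c r, (scl R N c <= r%:E)%E ->
    `|chain_eval mu c| <= K * r.
Proof.
move=> nN muQ; have [[qmu _] _] := muQ.
have [D D0 HD] := (quasimorphismP mu).1 qmu.
exists (2 * D) => [|c r]; first by rewrite mulr_ge0.
rewrite /scl; case: xgetP => [_ -> [k [z [k0 Nz zc ->]]] |_];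
  last by rewrite leye_eq.
have kR0 : 0 < k%:R :> R by rewrite ltr0n.
rewrite /sclZ; case: xgetP => [_ -> [m [n [x [y [Nx Ny ez ->]]]]] |_];
  last first.
  by rewrite gt0_muley ?leye_eq // lte_fin invr_gt0.
rewrite lee_pdivrMl // -EFinM => H.
rewrite ez in Nz; have := scl_expr_ge nN D0 muQ HD Nx Ny Nz H.
rewrite (_ : _ - _ = k%:R * chain_eval mu c).
  by rewrite normrM ger0_norm // mulrCA ler_pM2l.
have -> : k%:R * chain_eval mu c = chain_eval mu (chain_intr z).
  by rewrite zc chain_evalZ ratr_nat.
rewrite ez -!seq_chain_codom chain_intrD chain_intrN chain_evalB
  !chain_eval_seq.
by rewrite !big_map.
Qed.

(** * The filling seminorm bounds scl from above *)

Section Filling.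
Context {G : groupType}.
Implicit Types (g h : G) (c : {freeg G / rat}).

(* scl of the boundary of [(g, h)] vanishes when g and h commute; charging
   nothing for such pairs makes the dual functionals homogeneous. *)
Definition pair_cost g h : nat := (g * h != h * g)%g.

(** The upper bounds of the filling seminorm, in the relational form required of [bound] above. The
    slack in [filling0] makes them upward closed. *)
Inductive filling : {freeg G / rat} -> rat -> Prop :=
| filling0 q : 0 <= q -> filling 0 q
| filling_pair a g h c q : filling c q ->
    filling (a *: (<< h >> - << (g * h)%g >> + << g >>) + c)
      (`|a| * (pair_cost g h)%:R + q).

Lemma filling_ge0 c q : filling c q -> 0 <= q.
Proof. by elim=> // a g h {}c {}q _ q0; rewrite addr_ge0 // mulr_ge0. Qed.

Lemma fillingD c d q r : filling c q -> filling d r -> filling (c + d) (q + r).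
Proof.
move=> Hc Hd; elim: Hc => [{}q q0|a g h {}c {}q _ IH]; last first.
  by rewrite -addrA -[X in filling _ X]addrA; exact: filling_pair.
rewrite add0r; elim: Hd => [{}r r0|a g h {}d {}r _ IH];
  first by apply: filling0; rewrite addr_ge0.
by rewrite addrCA; exact: filling_pair.
Qed.

Lemma fillingZ a c q : filling c q -> filling (a *: c) (`|a| * q).
Proof.
elim=> [{}q q0|b g h {}c {}q _ IH]; first by rewrite scaler0; apply: filling0;
  rewrite mulr_ge0.
by rewrite scalerDr scalerA mulrDr mulrA -normrM; exact: filling_pair.
Qed.

Lemma fillingN c q : filling c q -> filling (- c) q.
Proof. by move=> /(fillingZ (-1)); rewrite scaleN1r normrN1 mul1r. Qed.

Lemma filling_le c q r : q <= r -> filling c q -> filling c r.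
Proof.
move=> qr Hc; rewrite -[c]addr0 -[r](subrKC q); apply: fillingD Hc _.
by apply: filling0; rewrite subr_ge0.
Qed.

(** Passing from [j] to [j + 1] moves one [h] past a power of [g], so [h ^+ j * g ^+ j] and
    [(g * h) ^+ j] differ by [j] commutators, and by none if [g] and [h] commute. *)
Lemma growth_pair g h : growth_le (N := [set: G]) (fun j x => x ^+ j)%g
  (pair_cost g h) (<< h >> - << (g * h)%g >> + << g >>).
Proof.
have nT := normal_subgroupT G.
exists [:: h; g], [:: (g * h)%g]; split.
  by rewrite /seq_chain !big_cons !big_nil !addr0 addrAC.
exists 0%N => j; rewrite !big_cons !big_nil !mulg1 addn0 /pair_cost.
case: eqP => [gh|_] /=.
  by rewrite gh expgMn ?mul0n; [exact: near_comm_refl|exact/commute_sym].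
rewrite mul1n; apply: (near_comm_sym nT).
elim: j => [|j IH]; first by rewrite !expg0 mulg1; exact: near_comm_refl.
rewrite !expgSr -addn1.
have H1 := near_commM nT IH (near_comm_refl (g * h)%g).
have H2 := near_commM nT (near_comm_refl (h ^+ j)%g)
  (near_commC (N := [set: G]) (g ^+ j * g)%g (x := h) I).
rewrite !mulgA in H1 H2.
by have := near_comm_trans H1 H2; rewrite addn0 add0n !mulgA.
Qed.

(** Clearing denominators makes a rational filling integral, with slope [n] at most [M * q] for the
    multiple [z] of [c] by [M]. *)
Lemma filling_growth c q : filling c q -> exists M n (z : {freeg G / int}),
  [/\ (0 < M)%N, CZ [set: G] z, chain_intr z = M%:R *: c,
   growth_le (N := [set: G]) (fun j x => x ^+ j)%g n z & n%:R <= M%:R * q].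
Proof.
have nT := normal_subgroupT G.
elim=> [{}q q0|a g h {}c {}q _ [M [n [z [M0 Tz zc zn nq]]]]].
  exists 1%N, 0%N, 0; split=> //; first exact: mixed_boundaries0.
  - by rewrite chain_intr0 scaler0.
  - exact: growth_le0.
  - by rewrite mul1r.
have d0 : (0 < `|denq a|)%N by rewrite absz_gt0 denq_neq0.
have dE : (`|denq a|%N)%:R = (denq a)%:~R :> rat.
  by rewrite pmulrn gtz0_abs ?denq_gt0.
(* Multiplication by [M * denq a] turns the coefficient [a] into the integer [M * numq a]. *)
exists (M * `|denq a|)%N, (pair_cost g h * `|(M%:Z * numq a)%R| + n * `|denq
  a|)%N.
exists ((M%:Z * numq a) *: (<< h >> - << (g * h)%g >> + << g >>) + denq a *: z).
split.
- by rewrite muln_gt0 M0.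
- apply: mixed_boundariesD; last exact: mixed_boundariesZ.
  by apply: mixed_boundariesZ; exact: (mixed_boundariesU _ nT).
- rewrite chain_intrD !chain_intrZ zc !chain_intrD chain_intrN !chain_intrU.
  rewrite scalerA rmorphM /= numqE natrM dE -pmulrn [RHS]scalerDr scalerA.
  by congr (_ *: _ + _ *: _); ring.
- by apply: (growth_leD nT); apply: (growth_leZ nT) => //; exact: growth_pair.
rewrite natrD !natrM mulrDr abszM natrM absz_nat.
have nE : (`|numq a|%N)%:R = `|a| * (`|denq a|%N)%:R :> rat.
  rewrite dE natr_absz intr_norm numqE normrM.
  by rewrite [`|(denq a)%:~R|]gtr0_norm // ltr0z denq_gt0.
rewrite nE lerD //; first by rewrite le_eqVlt; apply/orP; left; apply/eqP; ring.
by rewrite mulrAC ler_pM2r ?ltr0n.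
Qed.

End Filling.

(** * Multiples of chains and powers of products *)

Section GrowthMultiple.
Context {G : groupType} {N : set G}.
Hypothesis nN : normal_subgroup N.

Lemma seq_chain_flatten_nseq M (s : seq G) :
  seq_chain (flatten (nseq M s)) = seq_chain s *+ M.
Proof.
elim: M => [|M IH]; first by rewrite /seq_chain big_nil.
by rewrite /= seq_chain_cat IH mulrS.
Qed.

Lemma prod_flatten_nseq M (s : seq G) (f : G -> G) :
  (\prod_(x <- flatten (nseq M s)) f x = (\prod_(x <- s) f x) ^+ M)%g.
Proof.
elim: M => [|M IH]; first by rewrite big_nil.
by rewrite /= big_cat IH expgS.
Qed.

Lemma near_comm_prodX M (s : seq G) (f : G -> G) : {in s, forall x, N (f x)} ->
  near_comm N (size s * M) (\prod_(x <- s) f x ^+ M)%g ((\prod_(x <- s) f x) ^+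
    M)%g.
Proof.
move=> Nf; elim: M => [|M IH].
  by rewrite big1 ?muln0 ?expg0 => [|x _]; rewrite ?expg0 //;
    exact: near_comm_refl.
rewrite (eq_bigr (fun x => f x ^+ M * f x)%g) => [|x _]; last exact: expgSr.
rewrite expgSr mulnS.
have H := near_comm_prodM nN (fun x => f x ^+ M)%g Nf.
have := near_comm_trans H (near_commM nN IH (near_comm_refl (\prod_(x <- s) f
  x)%g)).
by rewrite addn0.
Qed.

End GrowthMultiple.

(** [M] copies of an expression give [M]-th powers of its products. Moving the power inside turns
    the exponent [j] into [j * M] at a cost independent of [j]. *)
Lemma growth_le_multiple (G : groupType) (c M : nat) m n (x : 'I_m -> G) (y :
  'I_n -> G) :
  growth_le (N := [set: G]) (fun j z => z ^+ j)%g c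
    ((\sum_(i < m) << x i >> - \sum_(j < n) << y j >>) *+ M) ->
  exists C, forall j, mixed_prod [set: G] (c * j + C) (expr_power x y (j * M)).
Proof.
have nT := normal_subgroupT G => Hg.
pose s := map x (index_enum 'I_m); pose t := map y (index_enum 'I_n).
have [//||C HC] := growth_leP nT _ (s := flatten (nseq M s)) (t :=
  flatten (nseq M t)) Hg.
  by rewrite !seq_chain_flatten_nseq !seq_chain_codom -mulrnBl.
(* The terms pay, in order, for the powers over [s], the comparison of both sides, the powers over
   [t], and the product of inverses. *)
exists (size s * M + C + size t * M + size t)%N => j.
have := HC j; rewrite !prod_flatten_nseq => H1.
have PX k (w : 'I_k -> G) : (\prod_(z <- map w (index_enum 'I_k)) (z ^+ j) ^+
  M)%g =
    (\prod_(i < k) w i ^+ (j * M))%g.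
  by rewrite big_map; apply: eq_bigr => i _; rewrite expgnA.
have hs := near_comm_prodX nT M (s := s) (f :=
  fun z => z ^+ j)%g (fun _ _ => I).
have ht := near_comm_prodX nT M (s := t) (f :=
  fun z => z ^+ j)%g (fun _ _ => I).
rewrite PX in hs; rewrite PX in ht.
have hx := near_comm_trans (near_comm_trans hs H1) (near_comm_sym nT ht).
have := near_comm_trans
  (near_commM nT hx (near_comm_refl (\prod_(i < n) y i ^- (j * M))%g))
  (near_comm_prodV nT (s := index_enum 'I_n) (f :=
    fun i => y i ^+ (j * M))%g (fun _ _ => I)).
rewrite /near_comm divg1 size_index_ord -/(expr_power x y (j * M)).
rewrite [X in mixed_prod _ X](_ : _ = (c * j + (size s * M + C + size t * M +
  size t))%N) //.
have st : size t = n by rewrite size_map size_index_ord.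
by rewrite st; lia.
Qed.

(** The multiple [z] and its expression are selected by [xget], while the growth bound is known for
    another multiple [w]. A common multiple transfers the bound from [w] to the selected
    expression. *)
Lemma scl_le (R : realType) (G : groupType) (c : {freeg G / rat}) q :
  filling c q -> (scl R [set: G] c <= (ratr q)%:E)%E.
Proof.
have nT := normal_subgroupT G.
move=> /filling_growth[M [n [w [M0 Tw wc wn nq]]]].
rewrite /scl; case: xgetP => [_ -> [k [z [k0 Tz zc ->]]] |]; last first.
  by move=> /(_ (M%:R^-1%:E * sclZ R [set: G] w)%E) []; exists M, w.
rewrite /sclZ; case: xgetP => [_ -> [m [p [x [y [Tx Ty ez ->]]]]] |];
  last first.
  have [s [t st]] := seq_chain_expr z.
  pose x := tnth (in_tuple s); pose y := tnth (in_tuple t).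
  move=> /(_ (scl_expr R [set: G] x y)) []; exists (size s), (size t), x, y;
    split=> //.
  by rewrite st /seq_chain (big_tnth _ _ s) (big_tnth _ _ t).
rewrite ez in Tz.
have [l Hl] := mixed_boundary_trivial nT Tx Ty Tz.
have [a [L [aL -> _ amin]]] := scl_expr_cvg (R := R) nT Tx Ty Hl.
have zw : z *+ M = w *+ k.
  apply: chain_intr_inj; rewrite -!scaler_nat.
  by rewrite !chain_intrZ zc wc !scalerA !rmorph_nat mulrC.
have := growth_leMn nT k wn; rewrite -zw ez => /growth_le_multiple[C HC].
(* Along the exponents [j * M] the length is at most [n * k * j + C], and its quotient by [j] tends
   to [M * L]. Signs are reversed because [cvgn_ratio_ge] bounds limits from below. *)
have LM : M%:R * L <= (n * k)%:R.
  have MuL : (fun j => - (M%:R * ((j * M)%:R^-1 * (a (j * M)%N)%:R))) @ \oo -->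
    - (M%:R * L).
    apply: cvgN; apply: cvgMr.
    exact: (cvg_comp _ _ (cvg_mulnr _ M0) aL).
  rewrite -lerN2; apply: (cvgn_ratio_ge (C := C%:R) MuL) => j.
  have ajM : (a (j * M)%N)%:R <= (n * k * j + C)%:R :> R by rewrite ler_nat
    amin.
  case: j ajM => [|j] ajM; first by rewrite !mul0r add0r.
  have -> : j.+1%:R * - (M%:R * ((j.+1 * M)%:R^-1 * (a (j.+1 * M)%N)%:R)) =
      - (a (j.+1 * M)%N)%:R :> R.
    by rewrite mulrN [_ * (M%:R * _)]mulrA -natrM mulVKf // pnatr_eq0 muln_eq0
      negb_or -!lt0n M0.
  by move: ajM; rewrite natrD natrM; lra.
rewrite -EFinM lee_fin ler_pdivrMl ?ltr0n //.
rewrite -(ler_pM2l (x := M%:R)) ?ltr0n //; apply: le_trans LM _.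
have : ratr n%:R <= ratr (M%:R * q) :> R by rewrite ler_rat.
rewrite rmorphM /= !ratr_nat natrM => H.
by rewrite mulrCA mulrC ler_pM2l ?ltr0n.
Qed.

(** * Invariant functions and the equivalence *)

(** The composite of [h] with the retraction agrees with [h] on [N] and vanishes on the boundary of
    each generating pair, even when single terms of that boundary leave [N]. *)
Lemma H1_inv_mixed_boundary (R : realType) (G : groupType) (N : set G)
    (h : G -> R) c :
  normal_subgroup N -> H1_inv N h -> CQ N c -> chain_eval h c = 0.
Proof.
move=> nN [hM hJ] [Nc [e Ce ec]].
have [t [Nt tN tM]] := coset_translation nN.
rewrite (eq_chain_eval (mu' := h \o t)) => [|x /Nc Nx]; last by rewrite /= tN.
rewrite -ec; move: e Ce {ec}; apply: C2'_ind => [|e f He Hf|a e He|[g x] /= Np].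
- by rewrite raddf0 chain_eval0.
- by rewrite raddfD chain_evalD He Hf addr0.
- by rewrite boundaryZ chain_evalZ He mulr0.
rewrite boundaryU chain_evalD chain_evalB !chain_evalU /=.
case: Np => [Ng|Nx].
  rewrite (conjgC g) tM ?[t g]tN //; last exact: normalJ.
  by rewrite hM ?hJ //; [ring|exact: normalJ].
by rewrite tM ?[t x]tN // hM //; ring.
Qed.

(** The values at [x ^+ k] and at its conjugate differ by at most [2 * D], and homogeneity makes
    this difference [k] times the one at [x]. *)
Lemma Q_conj_invariant (R : realType) (G : groupType) (phi : G -> R) :
  Q [set: G] phi -> Q_inv [set: G] phi.
Proof.
move=> Qphi; have [qphi homo] := Qphi; split=> // g x _.
have [D D0 HD] := (quasimorphismP phi).1 qphi.
have v0 : (fun=> 0 : R) @ \oo --> (0 : R) by exact: cvg_cst.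
suff : `|phi (x ^ g)%g - phi x| <= 0 by rewrite normr_le0 subr_eq0 => /eqP.
apply: (cvgn_ratio_ge (C := 2 * D) v0) => k; rewrite mulr0 add0r.
rewrite -[k%:R]normr_nat -normrM mulrBr -!(homogeneousX _ homo) // -conjXg
  conjgE.
have := HD g^-1%g (x ^+ k * g)%g I I; have := HD (x ^+ k)%g g I I.
rewrite (homogeneousV homo) // !ler_norml => /andP[? ?] /andP[? ?].
by apply/andP; split; lra.
Qed.

Theorem theorem2p3 (R : realType) (G : groupType) (N : set G)
    (normalN : normal_subgroup N) (A : set {freeg G / rat})
    (coarse_kernelA : coarse_kernel (CQ N)
       (scl_dist R N) (scl_dist R [set: G]) (@iotaQ G) A)
    (mu : G -> R) (muQ : Q_inv N mu) :
  (exists phi : G -> R, Q [set: G] phi /\ H1_inv N (fun x => mu x - phi x)) <->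
  bounded_set (chain_eval mu @` A).
Proof.
have nT := normal_subgroupT G.
have [AN [r Ar] Amax] := coarse_kernelA.
split=> [[phi [Qphi muphi]]|[m [_ muA]]].
  have [K K0 HK] := scl_ge nT (Q_conj_invariant Qphi).
  (* [dist_bounded] controls differences only, so values on [A] are compared with the one at a base
     point. *)
  have [->|/set0P[a0 Aa0]] := eqVneq A set0.
    by exists 0; split=> // M _ _ [? []].
  exists (`|chain_eval mu a0| + K * r); split; first exact: num_real.
  move=> M rM _ [a Aa <-]; apply: le_trans (ltW rM).
  have Naa0 : CQ N (a - a0) by apply: mixed_boundariesB; exact: AN.
  have -> : chain_eval mu a = chain_eval mu a0 + chain_eval phi (a - a0).
    apply/eqP; rewrite addrC -subr_eq -chain_evalB -subr_eq0.
    rewrite -(H1_inv_mixed_boundary normalN muphi Naa0) subr_eq.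
    by rewrite -chain_evalDl; apply/eqP/eq_chain_eval => x _; rewrite subrK.
  apply: le_trans (ler_normD _ _) _; rewrite lerD2l; apply: HK.
  by apply: Ar; [exists a|exists a0].
have [K K0 HK] := scl_ge normalN muQ.
(* The unit ball of the filling seminorm. Differences of its elements have fillings of cost 2, so it
   is bounded for [scl] on [G] and hence coarsely contained in [A]. *)
pose B := [set c | CQ N c /\ filling c 1].
have BN : B `<=` CQ N by move=> c [].
have Bb : dist_bounded (scl_dist R [set: G]) (iotaQ (G := G) @` B).
  exists (ratr 2) => _ _ [b [_ Hb] <-] [b' [_ Hb'] <-].
  exact: (scl_le R (fillingD Hb (fillingN Hb'))).
have [s [s0 Bs]] := Amax B BN Bb.
(* [bounded_set] gives a bound by every number above [m], hence the [+ 1]; [K * s] accounts for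
   moving to a nearby point of [A]. *)
pose L := `|m| + 1 + K * s.
have L0 : 0 <= L by rewrite !addr_ge0 // mulr_ge0.
have muB c : CQ N c -> filling c 1 -> `|chain_eval mu c| <= L.
  move=> Nc fc; have [a [Aa ca]] := Bs c (conj Nc fc).
  have -> : chain_eval mu c = chain_eval mu a + chain_eval mu (c - a).
    by rewrite chain_evalB addrC subrK.
  apply: le_trans (ler_normD _ _) _; apply: lerD; last exact: HK.
  apply: muA; last by exists a.
  by apply: le_lt_trans (ler_norm m) _; rewrite ltrDl.
have muL c q : CQ N c -> filling c q -> chain_eval mu c <= L * ratr q.
  move=> Nc fc; have q0 := filling_ge0 fc.
  (* Division by [q + e] brings [c] into the unit ball; the positive [e] covers the case [q = 0] and
     then tends to 0 along [1 / (k + 1)]. *)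
  suff H (e : rat) : 0 < e -> chain_eval mu c <= L * ratr (q + e).
    have v0 : (fun k => L * ratr (q + k.+1%:R^-1) : R) @ \oo --> L * ratr q.
      apply: cvgMr; rewrite -[X in _ --> X]addr0.
      rewrite (_ : (fun k => _) = (fun k => ratr q + k.+1%:R^-1)); last first.
        by apply/funext => k; rewrite rmorphD fmorphV /= ratr_nat.
      by apply: cvgD; [exact: cvg_cst|exact: cvg_harmonic].
    apply: (cvgn_ratio_ge (C := 0) v0) => k.
    by rewrite addr0 ler_wpM2l // H.
  move=> e0; have qe0 : 0 < q + e by rewrite ltr_wpDl.
  have Rqe0 : 0 < ratr (q + e) :> R by rewrite ltr0q.
  have f1 : filling ((q + e)^-1 *: c) 1.
    apply: (filling_le _ (fillingZ (q + e)^-1 fc)).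
    by rewrite gtr0_norm ?invr_gt0 // ler_pdivrMl // mulr1 lerDl ltW.
  have := muB _ (mixed_boundariesZ _ Nc) f1.
  by rewrite chain_evalZ fmorphV ler_norml => /andP[_];
    rewrite ler_pdivrMl // mulrC.
pose bound (c : {freeg G / rat}) (y : R) := exists2 q,
  filling c q & y = L * ratr q.
(* The functional to be extended is evaluation of [mu] on C_Q(G,N), dominated by [L] times the
   filling seminorm thanks to [muL]. *)
have [|||||F [FD Fmu Fb]] := @hahn_banach_rat R {freeg G / rat} bound _ _ _ _
  [set p | CQ N p.1 /\ p.2 = chain_eval mu p.1].
- by exists 0; [exact: filling0|rewrite rmorph0 mulr0].
- move=> u v _ _ [q fq ->] [q' fq' ->].
  by exists (q + q'); [exact: fillingD|rewrite rmorphD mulrDr].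
- move=> a u _ a0 [q fq ->]; exists (a * q); last by rewrite rmorphM mulrCA.
  by rewrite -{2}(gtr0_norm a0); exact: fillingZ.
- by move=> u _ [q fq ->]; exists q => //; exact: fillingN.
- split=> /=.
  + by split; [exact: mixed_boundaries0|rewrite chain_eval0].
  + move=> u v _ _ [Nu ->] [Nv ->].
    by split; [exact: mixed_boundariesD|rewrite chain_evalD].
  + move=> a u _ [Nu ->].
    by split; [exact: mixed_boundariesZ|rewrite chain_evalZ].
  + by move=> u _ _ [Nu ->] [q fq ->]; exact: muL.
have F0 : F 0 = 0 by have := FD 0 0; rewrite addr0; lra.
have FN u : F (- u) = - F u by have := FD u (- u); rewrite subrr F0; lra.
pose phi x := F << x >>.
have Fpair g h : F (<< h >> - << (g * h)%g >> + << g >>) = phi h - phi (g *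
  h)%g + phi g.
  by rewrite FD FD FN.
have phi_le g h : `|phi (g * h)%g - phi g - phi h| <= L * (pair_cost g h)%:R.
  have fgh := filling_pair 1 g h (filling0 (lexx 0)).
  rewrite scale1r addr0 normr1 mul1r addr0 in fgh.
  have bP u : filling u (pair_cost g h)%:R -> F u <= L * (pair_cost g h)%:R.
    by move=> fu; apply: Fb; exists (pair_cost g h)%:R; rewrite ?ratr_nat.
  have := bP _ fgh; have := bP _ (fillingN fgh);
    rewrite FN Fpair ler_norml => ? ?.
  by apply/andP; split; lra.
have FN_mu c : CQ N c -> F c = chain_eval mu c by move=> Nc; exact: Fmu.
exists phi; split; first split.
- apply/quasimorphismP; exists L => // x y _ _; apply: le_trans (phi_le x y) _.
  by rewrite /pair_cost; case: eqP => _; rewrite ?mulr0 // mulr1.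
(* Two elements of a cyclic subgroup commute, so their pair costs 0 and [phi_le] becomes
   additivity. *)
- move=> x _ y z cy cz.
  have yz : (y * z = z * y)%g.
    have cx w : cyclic_subgroup x w -> commute x w.
      by move=> [k [->|->]]; [|apply: commuteV]; apply: commuteX.
    have cyz : commute y x by apply/commute_sym/cx.
    case: cz => [k [->|->]]; [|apply: commuteV]; exact: commuteX.
  have := phi_le y z; rewrite /pair_cost yz eqxx mulr0 normr_le0 => /eqP; lra.
(* Both properties say that [F] and [mu] agree on particular elements of C_Q(G,N): boundaries of
   pairs in [N], and differences of conjugates. *)
- split=> [x y Nx Ny|g x Nx].
    have := FN_mu _ (mixed_boundariesU rat normalN Nx Ny).
    by rewrite Fpair chain_evalD chain_evalB !chain_evalU; lra.
  have := FN_mu _ (mixed_boundariesJ rat g normalN Nx).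
  by rewrite FD FN chain_evalB !chain_evalU /phi; lra.
Qed.
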